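(* There exists a set $G\subseteq \omega\times\omega$ with $\mathrm{wt}(G)<\infty$ such that for every c.e. set $D\subseteq\omega\times\omega$ with $\mathrm{wt}(D)<\infty$ we have $D\subseteq^* G$ (i.e. $D\setminus G$ is finite), and $G$ does not Turing-compute any $1$-random (Martin-Löf random) real.
   Context: For $X\subseteq\omega\times\omega$, the weight of $X$ is $\mathrm{wt}(X)=\sum_{(n,m)\in X}2^{-n}$. A c.e. set $D\subseteq\omega\times\omega$ with $\mathrm{wt}(D)<\infty$ is called a c.e. discrete covering (DC) instance. *)

(* Defs.v *)
From Stdlib Require Import Reals Lra Lia List.
Import ListNotations.
Open Scope R_scope.

Definition cpair (x y : nat) : nat := ((x + y) * (x + y + 1) / 2 + y)%nat.

(** Codes of partial recursive functions nat -> nat (with pairing) relative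
    to an oracle.  This is a standard Turing-complete basis. *)
Inductive code : Type :=
| CZero | CSucc | CId | CFst | CSnd | COrc
| CComp (f g : code)
| CPair (f g : code)
| CRec  (f g : code)      (* <x,0> |-> f x ; <x,n+1> |-> g <x,<n, h<x,n>>> *)
| CMu   (f : code).       (* x |-> least n with f <x,n> = 0 (earlier values defined, nonzero) *)

Inductive ev (A : nat -> Prop) : code -> nat -> nat -> Prop :=
| ev_zero x : ev A CZero x 0
| ev_succ x : ev A CSucc x (S x)
| ev_id x : ev A CId x x
| ev_fst x y : ev A CFst (cpair x y) x
| ev_snd x y : ev A CSnd (cpair x y) y
| ev_orc1 x : A x -> ev A COrc x 1
| ev_orc0 x : ~ A x -> ev A COrc x 0
| ev_comp f g x y z : ev A g x y -> ev A f y z -> ev A (CComp f g) x z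
| ev_pair f g x y z : ev A f x y -> ev A g x z -> ev A (CPair f g) x (cpair y z)
| ev_rec0 f g x y : ev A f x y -> ev A (CRec f g) (cpair x 0) y
| ev_recS f g x n y z :
    ev A (CRec f g) (cpair x n) y -> ev A g (cpair x (cpair n y)) z ->
    ev A (CRec f g) (cpair x (S n)) z
| ev_mu f x n :
    ev A f (cpair x n) 0 ->
    (forall m, (m < n)%nat -> exists k, k <> 0%nat /\ ev A f (cpair x m) k) ->
    ev A (CMu f) x n.

Definition empty_oracle : nat -> Prop := fun _ => False.
Definition ce (W : nat -> Prop) : Prop :=
  exists e : code, forall x, W x <-> exists y, ev empty_oracle e x y.

Definition set2 := nat -> nat -> Prop.
Definition code2 (X : set2) : nat -> Prop :=
  fun k => exists n m, k = cpair n m /\ X n m.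
Definition ce2 (X : set2) : Prop := ce (code2 X).

(** wt(X) = sum_{(n,m) in X} 2^{-n}; finite weight = the (nonnegative) sum
    converges, i.e. all finite partial sums are bounded. *)
Definition wsum (l : list (nat * nat)) : R :=
  fold_right (fun p s => (/ 2) ^ (fst p) + s) 0 l.
Definition finite_weight (X : set2) : Prop :=
  exists B : R, forall l : list (nat * nat),
    NoDup l -> (forall p, In p l -> X (fst p) (snd p)) -> wsum l <= B.

Definition almost_sub (D G : set2) : Prop :=
  exists l : list (nat * nat), forall n m, D n m -> ~ G n m -> In (n, m) l.

Definition turing_le (Z : nat -> bool) (A : nat -> Prop) : Prop :=
  exists e : code, forall x, ev A e x (if Z x then 1%nat else 0%nat).

(** Binary strings, coded bijectively as naturals. *)
Fixpoint strcode (s : list bool) : nat :=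
  match s with
  | [] => 0%nat
  | b :: t => (2 * strcode t + 1 + (if b then 1 else 0))%nat
  end.

Definition str_prefix (s t : list bool) : Prop := exists u, t = s ++ u.
Definition prefix_of (s : list bool) (Z : nat -> bool) : Prop :=
  forall i, (i < length s)%nat -> nth i s false = Z i.

Definition unif_ce (U : nat -> list bool -> Prop) : Prop :=
  ce (fun k => exists n s, k = cpair n (strcode s) /\ U n s).

(** mu([S]) <= r, expressed as: every finite prefix-free subset of S has
    total weight sum 2^{-|s|} <= r (the sup of these is mu([S])). *)
Definition ssum (l : list (list bool)) : R :=
  fold_right (fun s acc => (/ 2) ^ (length s) + acc) 0 l.
Definition prefix_free (l : list (list bool)) : Prop :=
  NoDup l /\ forall s t, In s l -> In t l -> s <> t -> ~ str_prefix s t.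
Definition measure_le (S : list bool -> Prop) (r : R) : Prop :=
  forall l, prefix_free l -> (forall s, In s l -> S s) -> ssum l <= r.

Definition ML_test (U : nat -> list bool -> Prop) : Prop :=
  unif_ce U /\ forall n, measure_le (U n) ((/ 2) ^ n).

Definition ML_random (Z : nat -> bool) : Prop :=
  forall U, ML_test U -> exists n, forall s, U n s -> ~ prefix_of s Z.

(* Main.v *)
Require Import Defs.
From Stdlib Require Import Reals List.
From Stdlib Require Import Lra Lia Arith ZArith Bool FinFun Classical ClassicalEpsilon.
Import ListNotations.
Open Scope nat_scope.

(** The set [G] is built by forcing.  A condition fixes [G] on an initial segment
    and promises that beyond it [G] contains a given set [D] of finite weight (not
    necessarily c.e.) and has weight at most [beta] outside [D].  Adding a set of
    finite weight to the promise costs only a small tail, which takes care of the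
    c.e. instances.

    To keep [Phi^G] from being random, first try to promise a set [E] of small weight
    that forces [Phi^G] to be partial.  If this fails everywhere, then for every [k]
    there is a set [T] of strings of one length and measure at most [2^-k] that is
    [eps]-big: every [E] of weight below [eps] is contained in a finite extension
    [rho] of the stem with [Phi^rho] in [T].  Such a [T] can be searched for
    effectively, and its measure can be made as small as we like for a fixed [eps], so
    summing over all stems yields a Martin-Loef test depending on [Phi] only; applying
    bigness to [E = D] gives an extension of the condition captured by the test.

    The set [T] comes from repeated halving.  Given finitely many [tau] with labels
    [Phi^tau] in [T], choose a random half [J] of the long extensions of the labels
    in [T].  Above a fixed [tau], call [J] excluded if some [E] of weight at most [v]
    has no extension labelled in [J].  If [E1], [E2], [E3] exclude [J1], [J2], [J3],
    their union excludes [J1], [J2] and [J3] at once; so either some [E] of weight at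
    most [3v] leaves only few labels, and these may be added to [J] at negligible
    cost, or the complements of the excluded sets are three-wise intersecting in many
    points and hence exponentially rare.  A union bound finds one [J] that works
    above all [tau], and no bigness is lost. *)

(** * Pairing and determinism *)

(** Walks along the antidiagonals in the order in which [cpair] numbers them, so that inverting
    [cpair] requires no square root. *)
Fixpoint unpair (n : nat) : nat * nat :=
  match n with
  | 0 => (0, 0)
  | S n => match unpair n with
           | (0, y) => (S y, 0)
           | (S x, y) => (x, S y)
           end
  end.
Definition un1 n := fst (unpair n).
Definition un2 n := snd (unpair n).

(** Doubling removes the division, after which the arithmetic tactics see only polynomials. *)
Lemma cpair_tri x y : 2 * cpair x y = (x + y) * (x + y + 1) + 2 * y.
Proof.
  unfold cpair.
  assert (H : exists k, (x + y) * (x + y + 1) = 2 * k).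
  { induction (x + y) as [|n [k IH]]; [now exists 0|]. exists (k + n + 1). lia. }
  destruct H as [k ->]. rewrite (Nat.mul_comm 2 k), Nat.div_mul; lia.
Qed.

Lemma cpair_unpair n : cpair (un1 n) (un2 n) = n.
Proof.
  unfold un1, un2. induction n as [|n IH]; [reflexivity|]. simpl.
  destruct (unpair n) as [[|x] y]; simpl in *.
  - pose proof (cpair_tri 0 y). pose proof (cpair_tri (S y) 0). nia.
  - pose proof (cpair_tri (S x) y). pose proof (cpair_tri x (S y)). nia.
Qed.

Lemma cpair_inj x y x' y' : cpair x y = cpair x' y' -> x = x' /\ y = y'.
Proof.
  intros E. pose proof (cpair_tri x y) as H. pose proof (cpair_tri x' y') as H'.
  rewrite E in H.
  (* All codes on one antidiagonal lie below those on the next, so the code determines the sum. *)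
  assert (x + y = x' + y') by (destruct (Nat.lt_trichotomy (x + y) (x' + y')) as [|[|]]; nia).
  nia.
Qed.

Lemma un1_cpair x y : un1 (cpair x y) = x.
Proof. exact (proj1 (cpair_inj _ _ _ _ (cpair_unpair (cpair x y)))). Qed.
Lemma un2_cpair x y : un2 (cpair x y) = y.
Proof. exact (proj2 (cpair_inj _ _ _ _ (cpair_unpair (cpair x y)))). Qed.

Lemma un1_le n : un1 n <= n.
Proof. pose proof (cpair_tri (un1 n) (un2 n)). rewrite cpair_unpair in H. nia. Qed.

Ltac cpair_eqs :=
  repeat match goal with
  | H : cpair _ _ = cpair _ _ |- _ => apply cpair_inj in H; destruct H; subst
  end.

Lemma ev_det A c : forall x y y', ev A c x y -> ev A c x y' -> y = y'.
Proof.
  induction c as [ | | | | | |f IHf g IHg|f IHf g IHg|f IHf g IHg|f IHf];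
    intros x y y' H H'.
  1-6: inversion H; subst; inversion H'; subst; cpair_eqs; try reflexivity; contradiction.
  - inversion H; subst. inversion H'; subst.
    assert (y0 = y1) by eauto. subst. eauto.
  - inversion H; subst. inversion H'; subst. f_equal; eauto.
  (* The rules for [CRec] are indexed by pairs, so [x] is written as a pair and a second induction
     runs over the recursion argument. *)
  - rewrite <- (cpair_unpair x) in H, H'.
    revert y y' H H'. generalize (un1 x) as a. induction (un2 x) as [|n IHn]; intros a y y' H H'.
    + inversion H; subst; cpair_eqs; [|discriminate].
      inversion H'; subst; cpair_eqs; [|discriminate]. eauto.
    + inversion H; subst; cpair_eqs; [discriminate|].
      inversion H'; subst; cpair_eqs; [discriminate|].
      match goal with E : S _ = S _ |- _ => injection E as -> end.
      match goal with E : S _ = S _ |- _ => injection E as -> end.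
      assert (y0 = y1) by eauto. subst. eauto.
  - inversion H as [| | | | | | | | | | |f1 x1 n H1 H2]; subst.
    inversion H' as [| | | | | | | | | | |f2 x2 n' H1' H2']; subst.
    (* The smaller of two distinct results would be a zero where the other search demands a nonzero
       value. *)
    destruct (Nat.lt_trichotomy y y') as [L|[L|L]]; [|exact L|]; exfalso.
    + destruct (H2' y L) as [k [Hk E]]. apply Hk. eauto.
    + destruct (H2 y' L) as [k [Hk E]]. apply Hk. eauto.
Qed.

(** * Computable total functions *)

Class Enc (X : Type) := enc : X -> nat.
Instance enc_nat : Enc nat := fun n => n.
Instance enc_prod X `{Enc X} : Enc (X * nat) := fun p => cpair (enc (fst p)) (snd p).

(** A single code has to work for every oracle. Several arguments are passed as pairs nested to the
    left, encoded by [enc_prod]. *)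
Definition cmpm {X Y} `{Enc X} `{Enc Y} (g : X -> Y) : Prop :=
  exists c, forall A x, ev A c (enc x) (enc (g x)).
Notation cmp f := (@cmpm _ nat _ _ f).

Section Cmp.
Context {X : Type} {EX : Enc X}.

Lemma cmp_ext (f g : X -> nat) : cmp f -> (forall x, f x = g x) -> cmp g.
Proof. intros [c Hc] E. exists c. intros A x. rewrite <- E. apply Hc. Qed.

Lemma cmp_snd : cmp (fun p : X * nat => snd p).
Proof. exists CSnd. intros A [x n]. apply ev_snd. Qed.

Lemma cmpm_fst : cmpm (fun p : X * nat => fst p).
Proof. exists CFst. intros A [x n]. apply ev_fst. Qed.

Lemma cmpm_id : cmpm (fun x : X => x).
Proof. exists CId. intros A x. apply ev_id. Qed.

Lemma cmpm_comp {Y Z} {EY : Enc Y} {EZ : Enc Z} (h : Y -> Z) (g : X -> Y) :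
  cmpm h -> cmpm g -> cmpm (fun x => h (g x)).
Proof. intros [c Hc] [d Hd]. exists (CComp c d). intros A x. eapply ev_comp; eauto. Qed.

Lemma cmpm_pair {Y} {EY : Enc Y} (g : X -> Y) (a : X -> nat) :
  cmpm g -> cmp a -> cmpm (fun x => (g x, a x)).
Proof. intros [c Hc] [d Hd]. exists (CPair c d). intros A x. apply ev_pair; [apply Hc|apply Hd]. Qed.

Lemma cmp_wk (f : X -> nat) : cmp f -> cmp (fun p : X * nat => f (fst p)).
Proof.
  intros [c Hc]. exists (CComp c CFst). intros A p.
  eapply ev_comp; [apply ev_fst|apply Hc].
Qed.

Lemma cmp_const k : cmp (fun _ : X => k).
Proof.
  induction k as [|k [c IH]]; [exists CZero; intros; apply ev_zero|].
  exists (CComp CSucc c). intros A x. eapply ev_comp; [apply IH|apply ev_succ].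
Qed.

Lemma cmp_rec (f : X -> nat) (g : X -> nat -> nat -> nat) (b : X -> nat) :
  cmp f -> cmp (fun p : X * nat * nat => g (fst (fst p)) (snd (fst p)) (snd p)) -> cmp b ->
  cmp (fun x => nat_rect (fun _ => nat) (f x) (g x) (b x)).
Proof.
  intros [cf Hf] [cg Hg] [cb Hb].
  (* [CRec] hands its step function the input <x,<n,y>>, whereas triples are nested to the left
     here; the inner pairing reassociates. *)
  exists (CComp (CRec cf (CComp cg (CPair (CPair CFst (CComp CFst CSnd)) (CComp CSnd CSnd))))
                (CPair CId cb)).
  intros A x. eapply ev_comp; [apply ev_pair; [apply ev_id|apply Hb]|].
  generalize (b x) as n. intros n. change (enc (b x)) with (b x).
  induction n as [|n IH]; simpl.
  - apply ev_rec0, Hf.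
  - eapply ev_recS; [exact IH|]. eapply ev_comp; [|apply (Hg A (x, n, _))].
    apply ev_pair; [apply ev_pair|].
    + apply ev_fst.
    + eapply ev_comp; [apply ev_snd|apply ev_fst].
    + eapply ev_comp; [apply ev_snd|apply ev_snd].
Qed.
End Cmp.
Notation cmp1 h := (cmp (fun x : nat => h x)).
Notation cmp2 h := (cmp (fun p : nat * nat => h (fst p) (snd p))).
Notation cmp3 h := (cmp (fun p : nat * nat * nat => h (fst (fst p)) (snd (fst p)) (snd p))).
Notation cmp4 h := (cmp (fun p : nat * nat * nat * nat =>
  h (fst (fst (fst p))) (snd (fst (fst p))) (snd (fst p)) (snd p))).
Notation cmpb f := (cmp (fun p => Nat.b2n (f p))).

Section CmpApply.
Context {X : Type} {EX : Enc X}.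

Lemma cmp_ap1 h (a : X -> nat) : cmp1 h -> cmp a -> cmp (fun x => h (a x)).
Proof. intros Hh Ha. exact (cmpm_comp h a Hh Ha). Qed.
Lemma cmp_ap2 h (a b : X -> nat) : cmp2 h -> cmp a -> cmp b -> cmp (fun x => h (a x) (b x)).
Proof. intros Hh Ha Hb. exact (cmpm_comp _ _ Hh (cmpm_pair _ _ Ha Hb)). Qed.
Lemma cmp_ap3 h (a b c : X -> nat) :
  cmp3 h -> cmp a -> cmp b -> cmp c -> cmp (fun x => h (a x) (b x) (c x)).
Proof. intros Hh Ha Hb Hc. exact (cmpm_comp _ _ Hh (cmpm_pair _ _ (cmpm_pair _ _ Ha Hb) Hc)). Qed.
Lemma cmp_ap4 h (a b c d : X -> nat) :
  cmp4 h -> cmp a -> cmp b -> cmp c -> cmp d -> cmp (fun x => h (a x) (b x) (c x) (d x)).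
Proof.
  intros Hh Ha Hb Hc Hd.
  exact (cmpm_comp _ _ Hh (cmpm_pair _ _ (cmpm_pair _ _ (cmpm_pair _ _ Ha Hb) Hc) Hd)).
Qed.

Lemma cmp_case (a f : X -> nat) (g : X -> nat -> nat) :
  cmp a -> cmp f -> cmp (fun p : X * nat => g (fst p) (snd p)) ->
  cmp (fun x => match a x with 0 => f x | S y => g x y end).
Proof.
  intros Ha Hf Hg.
  apply cmp_ext with (fun x => nat_rect (fun _ => nat) (f x) (fun n _ => g x n) (a x)).
  - apply cmp_rec; [exact Hf| |exact Ha].
    exact (cmpm_comp (fun p : X * nat => g (fst p) (snd p)) (fun q : X * nat * nat => fst q)
             Hg cmpm_fst).
  - intros x. cbv beta. now destruct (a x).
Qed.
End CmpApply.

Create HintDb cmpdb.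

Ltac cvar := lazymatch goal with
  | |- cmpm fst => apply cmpm_fst
  | |- cmpm snd => apply cmp_snd
  | |- cmpm (fun p => p) => apply cmpm_id
  | |- cmpm (fun p => @snd ?A nat (@?g p)) =>
      apply (cmpm_comp (fun q : A * nat => snd q) g); [apply cmp_snd|cvar]
  | |- cmpm (fun p => @fst ?A nat (@?g p)) =>
      apply (cmpm_comp (fun q : A * nat => fst q) g); [apply cmpm_fst|cvar]
  end.
Ltac cknown := solve [eauto with cmpdb nocore].
Ltac cstep := cbv beta; first
  [ solve [cvar]
  | lazymatch goal with
    | |- cmpm (fun _ => ?k) => apply cmp_const
    | |- cmpm (fun x => ?h (@?a x) (@?b x) (@?c x) (@?d x)) => apply (cmp_ap4 h a b c d); [cknown| | | |]
    | |- cmpm (fun x => ?h (@?a x) (@?b x) (@?c x)) => apply (cmp_ap3 h a b c); [cknown| | |]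
    | |- cmpm (fun x => ?h (@?a x) (@?b x)) => apply (cmp_ap2 h a b); [cknown| |]
    | |- cmpm (fun x => ?h (@?a x)) => apply (cmp_ap1 h a); [cknown|]
    end ].

Lemma cmp_S : cmp1 S.
Proof. exists CSucc. intros. apply ev_succ. Qed.
Lemma cmp_un1 : cmp1 un1.
Proof. exists CFst. intros A x. rewrite <- (cpair_unpair x) at 1. apply ev_fst. Qed.
Lemma cmp_un2 : cmp1 un2.
Proof. exists CSnd. intros A x. rewrite <- (cpair_unpair x) at 1. apply ev_snd. Qed.
Lemma cmp_cpair : cmp2 cpair.
Proof. exists CId. intros A x. apply ev_id. Qed.
#[local] Hint Resolve cmp_S cmp_un1 cmp_un2 cmp_cpair : cmpdb.

Ltac crec f g b :=
  apply cmp_ext with (fun x => nat_rect (fun _ => nat) (f x) (g x) (b x)); [apply cmp_rec|].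

Lemma cmp_add : cmp2 Nat.add.
Proof.
  crec (fun p : nat * nat => fst p) (fun (_ : nat * nat) (_ y : nat) => S y) (fun p : nat * nat => snd p);
    repeat cstep.
  intros [x n]; simpl. induction n; simpl; lia.
Qed.
#[local] Hint Resolve cmp_add : cmpdb.
Lemma cmp_pred : cmp1 Nat.pred.
Proof.
  crec (fun _ : nat => 0) (fun (_ : nat) (n _ : nat) => n) (fun n : nat => n); repeat cstep.
  now intros [|n].
Qed.
#[local] Hint Resolve cmp_pred : cmpdb.
Lemma cmp_sub : cmp2 Nat.sub.
Proof.
  crec (fun p : nat * nat => fst p) (fun (_ : nat * nat) (_ y : nat) => Nat.pred y)
    (fun p : nat * nat => snd p);
    repeat cstep.
  intros [x n]; simpl. induction n; simpl; lia.
Qed.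
#[local] Hint Resolve cmp_sub : cmpdb.
Lemma cmp_mul : cmp2 Nat.mul.
Proof.
  crec (fun p : nat * nat => 0) (fun (p : nat * nat) (_ y : nat) => y + fst p) (fun p : nat * nat => snd p);
    repeat cstep.
  intros [x n]; simpl. induction n; simpl in *; lia.
Qed.
#[local] Hint Resolve cmp_mul : cmpdb.
Lemma cmp_pow : cmp2 Nat.pow.
Proof.
  crec (fun p : nat * nat => 1) (fun (p : nat * nat) (_ y : nat) => fst p * y) (fun p : nat * nat => snd p);
    repeat cstep.
  intros [x n]; simpl. induction n; simpl in *; lia.
Qed.
(** The rounded-down halves of n and n + 1 add up to n, which is a primitive recursion for
    halving. *)
Lemma cmp_div2 : cmp1 Nat.div2.
Proof.
  crec (fun _ : nat => 0) (fun (_ : nat) (n y : nat) => n - y) (fun n : nat => n); repeat cstep.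
  intros n. induction n as [|n IH]; [reflexivity|]. cbn [nat_rect]. rewrite IH.
  pose proof (Nat.div2_odd n). pose proof (Nat.div2_odd (S n)).
  rewrite Nat.odd_succ, <- Nat.negb_odd in H0. destruct (Nat.odd n); simpl Nat.b2n in *; lia.
Qed.
Lemma cmp_odd : cmp1 (fun n => Nat.b2n (Nat.odd n)).
Proof.
  crec (fun _ : nat => 0) (fun (_ : nat) (n y : nat) => 1 - y) (fun n : nat => n); repeat cstep.
  intros n. induction n as [|n IH]; [reflexivity|]. cbn [nat_rect]. rewrite IH.
  rewrite Nat.odd_succ, <- Nat.negb_odd. now destruct (Nat.odd n).
Qed.
#[local] Hint Resolve cmp_pow cmp_div2 cmp_odd : cmpdb.

(** Bit i is the parity left after i halvings. *)
Lemma cmp_testbit : cmp2 (fun v i => Nat.b2n (Nat.testbit v i)).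
Proof.
  apply cmp_ext with (fun p => (fun n => Nat.b2n (Nat.odd n))
    (nat_rect (fun _ => nat) (fst p) (fun _ y => Nat.div2 y) (snd p))).
  - apply (cmp_ap1 (fun n => Nat.b2n (Nat.odd n))); [apply cmp_odd|].
    apply (cmp_rec (fun p : nat * nat => fst p) (fun _ _ y => Nat.div2 y) (fun p => snd p)); repeat cstep.
  - intros [v i]; simpl. f_equal. revert v. induction i as [|i IH]; intros v; [reflexivity|].
    simpl. rewrite <- IH. f_equal. clear. induction i as [|i IH]; simpl; [reflexivity|].
    now rewrite IH.
Qed.

Section CmpBool.
Context {X : Type} {EX : Enc X}.

Lemma cmpb_testbit (a b : X -> nat) : cmp a -> cmp b -> cmpb (fun x => Nat.testbit (a x) (b x)).
Proof. apply (cmp_ap2 (fun v i => Nat.b2n (Nat.testbit v i))), cmp_testbit. Qed.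
Lemma cmpb_and (a b : X -> bool) : cmpb a -> cmpb b -> cmpb (fun x => a x && b x).
Proof.
  intros Ha Hb. eapply cmp_ext; [exact (cmp_ap2 _ _ _ cmp_mul Ha Hb)|].
  intros x. cbv beta. now destruct (a x), (b x).
Qed.
Lemma cmpb_neg (a : X -> bool) : cmpb a -> cmpb (fun x => negb (a x)).
Proof.
  intros Ha. eapply cmp_ext; [exact (cmp_ap2 _ _ _ cmp_sub (cmp_const 1) Ha)|].
  intros x. cbv beta. now destruct (a x).
Qed.
Lemma cmpb_or (a b : X -> bool) : cmpb a -> cmpb b -> cmpb (fun x => a x || b x).
Proof.
  intros Ha Hb. eapply cmp_ext;
    [exact (cmpb_neg _ (cmpb_and _ _ (cmpb_neg _ Ha) (cmpb_neg _ Hb)))|].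
  intros x. cbv beta. now destruct (a x), (b x).
Qed.
Lemma cmpb_leb (a b : X -> nat) : cmp a -> cmp b -> cmpb (fun x => a x <=? b x).
Proof.
  intros Ha Hb. eapply cmp_ext;
    [exact (cmp_ap2 _ _ _ cmp_sub (cmp_const 1) (cmp_ap2 _ _ _ cmp_sub Ha Hb))|].
  intros x. cbv beta. destruct (Nat.leb_spec (a x) (b x)); simpl Nat.b2n; lia.
Qed.
Lemma cmpb_ltb (a b : X -> nat) : cmp a -> cmp b -> cmpb (fun x => a x <? b x).
Proof. intros Ha Hb. exact (cmpb_leb _ _ (cmp_ap1 _ _ cmp_S Ha) Hb). Qed.
Lemma cmpb_eqb (a b : X -> nat) : cmp a -> cmp b -> cmpb (fun x => a x =? b x).
Proof.
  intros Ha Hb. eapply cmp_ext; [exact (cmpb_and _ _ (cmpb_leb _ _ Ha Hb) (cmpb_leb _ _ Hb Ha))|].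
  intros x. cbv beta. f_equal. destruct (Nat.eqb_spec (a x) (b x)), (Nat.leb_spec (a x) (b x)),
    (Nat.leb_spec (b x) (a x)); simpl; try reflexivity; lia.
Qed.
Lemma cmp_if (b : X -> bool) (f g : X -> nat) :
  cmpb b -> cmp f -> cmp g -> cmp (fun x => if b x then f x else g x).
Proof.
  intros Hb Hf Hg.
  eapply cmp_ext; [exact (cmp_case _ _ (fun x _ => f x) Hb Hg (cmp_wk _ Hf))|].
  intros x. cbv beta. now destruct (b x).
Qed.
End CmpBool.

Fixpoint ball (n : nat) (P : nat -> bool) : bool :=
  match n with 0 => true | S n => P n && ball n P end.
Definition bex (n : nat) (P : nat -> bool) : bool := negb (ball n (fun i => negb (P i))).
Fixpoint nsum (n : nat) (f : nat -> nat) : nat :=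
  match n with 0 => 0 | S n => f n + nsum n f end.

Lemma ball_spec n P : ball n P = true <-> forall i, i < n -> P i = true.
Proof.
  induction n as [|n IH]; simpl; [split; [lia|reflexivity]|].
  rewrite andb_true_iff, IH. split.
  - intros [H1 H2] i Hi. destruct (Nat.eq_dec i n) as [->|]; [exact H1|]. apply H2. lia.
  - intros H. split; [|intros i Hi]; apply H; lia.
Qed.
Lemma bex_spec n P : bex n P = true <-> exists i, i < n /\ P i = true.
Proof.
  unfold bex. rewrite negb_true_iff. split.
  - intros H. apply NNPP. intros C.
    assert (ball n (fun i => negb (P i)) = true); [|congruence].
    apply ball_spec. intros i Hi. destruct (P i) eqn:E; [|reflexivity]. exfalso. eauto.
  - intros [i [Hi HP]]. apply not_true_is_false. intros H.
    rewrite ball_spec in H. specialize (H i Hi). now rewrite HP in H.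
Qed.

Section CmpBounded.
Context {X : Type} {EX : Enc X}.

Lemma cmpb_ball (b : X -> nat) (P : X -> nat -> bool) :
  cmp b -> cmpb (fun p : X * nat => P (fst p) (snd p)) -> cmpb (fun x => ball (b x) (P x)).
Proof.
  intros Hb HP.
  apply cmp_ext with (fun x => nat_rect (fun _ => nat) 1 (fun n y => Nat.b2n (P x n) * y) (b x)).
  - apply cmp_rec; [apply cmp_const| |exact Hb].
    apply (cmp_ap2 Nat.mul); [apply cmp_mul| |cvar].
    exact (cmpm_comp (fun p : X * nat => Nat.b2n (P (fst p) (snd p)))
             (fun q : X * nat * nat => fst q) HP cmpm_fst).
  - intros x. induction (b x) as [|n IH]; simpl; [reflexivity|].
    rewrite IH. destruct (P x n); simpl; lia.
Qed.
Lemma cmpb_bex (b : X -> nat) (P : X -> nat -> bool) :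
  cmp b -> cmpb (fun p : X * nat => P (fst p) (snd p)) -> cmpb (fun x => bex (b x) (P x)).
Proof.
  intros Hb HP. apply (cmpb_neg (fun x => ball (b x) (fun i => negb (P x i)))).
  apply cmpb_ball; [exact Hb|]. exact (cmpb_neg _ HP).
Qed.
Lemma cmp_nsum (b : X -> nat) (f : X -> nat -> nat) :
  cmp b -> cmp (fun p : X * nat => f (fst p) (snd p)) -> cmp (fun x => nsum (b x) (f x)).
Proof.
  intros Hb Hf.
  apply cmp_ext with (fun x => nat_rect (fun _ => nat) 0 (fun n y => f x n + y) (b x)).
  - apply cmp_rec; [apply cmp_const| |exact Hb].
    apply (cmp_ap2 Nat.add); [apply cmp_add| |cvar].
    exact (cmpm_comp (fun p : X * nat => f (fst p) (snd p))
             (fun q : X * nat * nat => fst q) Hf cmpm_fst).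
  - intros x. induction (b x) as [|n IH]; simpl; [reflexivity|]. now rewrite IH.
Qed.
End CmpBounded.

(** [CMu] looks for a zero, so it is applied to the negation of [R]; totality of [R] supplies the
    nonzero values before the least witness. *)
Lemma ce_search (R : nat -> nat -> bool) :
  cmpb (fun p : nat * nat => R (fst p) (snd p)) -> ce (fun x => exists w, R x w = true).
Proof.
  intros HR. destruct (cmpb_neg _ HR) as [c Hc]. exists (CMu c). intros x. split.
  - intros [w Hw]. induction w as [w IH] using lt_wf_ind.
    destruct (classic (exists m, m < w /\ R x m = true)) as [[m [Hm Rm]]|H]; [eauto|].
    exists w. apply ev_mu.
    + specialize (Hc empty_oracle (x, w)). simpl in Hc. rewrite Hw in Hc. exact Hc.
    + intros m Hm. exists 1. split; [discriminate|].
      specialize (Hc empty_oracle (x, m)). simpl in Hc.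
      destruct (R x m) eqn:E; [exfalso; eauto|exact Hc].
  - intros [y Hy]. inversion Hy as [| | | | | | | | | | |f x1 n H1 H2]; subst.
    exists y. pose proof (ev_det _ _ _ _ _ H1 (Hc empty_oracle (x, y))) as E.
    simpl in E. destruct (R x y); [reflexivity|discriminate].
Qed.

(** * Bounded evaluation with a finite oracle *)

(** The state of an unbounded search after k steps: 0 means still searching, 1 means stuck at an
    undefined value, and n + 2 means that the zero n was found. Values of [h] follow the convention
    of [run], so 1 stands for the output 0. Taking the predecessor turns the state into a result of
    [run]. *)
Definition mustate (h : nat -> nat) (k : nat) : nat :=
  nat_rect (fun _ => nat) 0
    (fun n st => match st with
                 | 0 => match h n with 0 => 1 | S r => match r with 0 => S (S n) | S _ => 0 end end
                 | S st' => S st'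
                 end) k.

(* The value [0] stands for "no output", [S y] for the output [y]; [k] bounds
   the unbounded searches and [N] is the length of the oracle string [f]. *)
Fixpoint run (e : code) (k N : nat) (f : nat -> bool) (x : nat) {struct e} : nat :=
  match e with
  | CZero => 1
  | CSucc => S (S x)
  | CId => S x
  | CFst => S (un1 x)
  | CSnd => S (un2 x)
  | COrc => if x <? N then S (Nat.b2n (f x)) else 0
  | CComp g h => match run h k N f x with 0 => 0 | S y => run g k N f y end
  | CPair g h => match run g k N f x with
                 | 0 => 0
                 | S y => match run h k N f x with 0 => 0 | S z => S (cpair y z) end
                 end
  | CRec g h => nat_rect (fun _ => nat) (run g k N f (un1 x))
                  (fun n r => match r with
                              | 0 => 0
                              | S y => run h k N f (cpair (un1 x) (cpair n y))
                              end) (un2 x)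
  | CMu g => Nat.pred (mustate (fun n => run g k N f (cpair x n)) k)
  end.

Definition agree (N : nat) (f g : nat -> bool) : Prop := forall x, x < N -> f x = g x.

Lemma mustate_0 h k : (forall m, m < k -> 2 <= h m) -> mustate h k = 0.
Proof.
  induction k as [|k IH]; intros H; [reflexivity|]. simpl.
  change (nat_rect _ _ _ k) with (mustate h k). rewrite IH by (intros; apply H; lia).
  specialize (H k ltac:(lia)). destruct (h k) as [|[|]]; lia.
Qed.
Lemma mustate_found h n k :
  n < k -> h n = 1 -> (forall m, m < n -> 2 <= h m) -> mustate h k = S (S n).
Proof.
  intros Hk Hn Hm. induction k as [|k IH]; [lia|]. simpl.
  change (nat_rect _ _ _ k) with (mustate h k).
  destruct (Nat.eq_dec n k) as [->|].
  - rewrite mustate_0 by exact Hm. now rewrite Hn.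
  - rewrite IH by lia. reflexivity.
Qed.
Lemma mustate_inv h k :
  (mustate h k = 0 -> forall m, m < k -> 2 <= h m) /\
  (forall n, mustate h k = S (S n) -> n < k /\ h n = 1 /\ forall m, m < n -> 2 <= h m).
Proof.
  induction k as [|k [IH0 IH1]]; [split; [lia|discriminate]|]. simpl.
  change (nat_rect _ _ _ k) with (mustate h k).
  destruct (mustate h k) as [|[|j]].
  - destruct (h k) as [|[|r]] eqn:E; split; try discriminate.
    + intros n [= <-]. split; [lia|]. split; [exact E|]. now apply IH0.
    + intros _ m Hm. destruct (Nat.eq_dec m k) as [->|]; [lia|]. apply IH0; [reflexivity|lia].
  - split; discriminate.
  - split; [discriminate|]. intros n [= <-]. destruct (IH1 j eq_refl). split; [lia|assumption].
Qed.

(** A successful computation rests only on subcomputations with an output and on oracle bits below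
    [N]; larger bounds preserve both. For [CMu] these are the values up to the zero found. *)
Lemma run_mono e : forall k N f x y k' N' f',
  run e k N f x = S y -> k <= k' -> N <= N' -> agree N f f' -> run e k' N' f' x = S y.
Proof.
  induction e as [ | | | | | |g IHg h IHh|g IHg h IHh|g IHg h IHh|g IHg];
    intros k N f x y k' N' f' H Hk HN Hf; simpl in *; try exact H.
  - destruct (Nat.ltb_spec x N); [|discriminate]. destruct (Nat.ltb_spec x N'); [|lia].
    rewrite <- Hf by assumption. exact H.
  - destruct (run h k N f x) as [|z] eqn:E; [discriminate|].
    rewrite (IHh _ _ _ _ _ _ _ _ E Hk HN Hf). eauto.
  - destruct (run g k N f x) as [|z] eqn:E; [discriminate|].
    destruct (run h k N f x) as [|z'] eqn:E'; [discriminate|].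
    rewrite (IHg _ _ _ _ _ _ _ _ E Hk HN Hf), (IHh _ _ _ _ _ _ _ _ E' Hk HN Hf). exact H.
  - revert y H. induction (un2 x) as [|n IHn]; simpl; intros y H; [eauto|].
    destruct (nat_rect _ _ _ n) as [|z] eqn:E; [discriminate|].
    rewrite (IHn _ eq_refl). eauto.
  - destruct (mustate _ k) as [|[|n]] eqn:E; simpl in H; try discriminate.
    injection H as <-. apply (proj2 (mustate_inv _ _)) in E. destruct E as [H1 [H2 H3]].
    rewrite (mustate_found _ n); [reflexivity|lia|eauto|].
    intros m Hm. specialize (H3 m Hm).
    destruct (run g k N f (cpair x m)) as [|z] eqn:E; [lia|].
    rewrite (IHg _ _ _ _ _ _ _ _ E Hk HN Hf). exact H3.
Qed.

Definition osub (A : nat -> Prop) (N : nat) (f : nat -> bool) : Prop :=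
  forall z, z < N -> (A z <-> f z = true).

Lemma run_sound A e : forall k N f x y, run e k N f x = S y -> osub A N f -> ev A e x y.
Proof.
  induction e as [ | | | | | |g IHg h IHh|g IHg h IHh|g IHg h IHh|g IHg];
    intros k N f x y H Hf; simpl in *.
  - injection H as <-. constructor.
  - injection H as <-. constructor.
  - injection H as <-. constructor.
  - injection H as <-. rewrite <- (cpair_unpair x) at 1. constructor.
  - injection H as <-. rewrite <- (cpair_unpair x) at 1. constructor.
  - destruct (Nat.ltb_spec x N) as [L|]; [|discriminate]. specialize (Hf x L).
    injection H as <-. destruct (f x); constructor; rewrite Hf; congruence.
  - destruct (run h k N f x) as [|z] eqn:E; [discriminate|]. econstructor; eauto.
  - destruct (run g k N f x) as [|z] eqn:E; [discriminate|].
    destruct (run h k N f x) as [|z'] eqn:E'; [discriminate|].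
    injection H as <-. constructor; eauto.
  - rewrite <- (cpair_unpair x).
    revert y H. induction (un2 x) as [|n IHn]; simpl; intros y H; [constructor; eauto|].
    destruct (nat_rect _ _ _ n) as [|z] eqn:E; [discriminate|]. econstructor; eauto.
  - destruct (mustate _ k) as [|[|n]] eqn:E; simpl in H; try discriminate.
    injection H as <-. apply (proj2 (mustate_inv _ _)) in E. destruct E as [H1 [H2 H3]].
    constructor; [eauto|]. intros m Hm. specialize (H3 m Hm).
    destruct (run g k N f (cpair x m)) as [|[|z]] eqn:E; [lia|lia|].
    exists (S z). split; [discriminate|eauto].
Qed.

Lemma agree_refl N f : agree N f f.
Proof. intros x _. reflexivity. Qed.

Lemma osub_le A N N' f : N <= N' -> osub A N' f -> osub A N f.
Proof. intros L H z Hz. apply H. lia. Qed.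

(** A computation makes finitely many searches and oracle questions, so maxima of bounds suffice.
    The bounds are chosen before [f] and hence serve every finite approximation of [A]. *)
Lemma run_complete A e : forall x y, ev A e x y ->
  exists k N, forall f, osub A N f -> run e k N f x = S y.
Proof.
  induction e as [ | | | | | |g IHg h IHh|g IHg h IHh|g IHg h IHh|g IHg]; intros x y H.
  1-5: exists 0, 0; intros f _; inversion H; subst; simpl; now rewrite ?un1_cpair, ?un2_cpair.
  - exists 0, (S x). intros f Hf. specialize (Hf x ltac:(lia)). simpl run.
    destruct (Nat.ltb_spec x (S x)); [|lia].
    inversion H; subst; destruct (f x); simpl; intuition congruence.
  - inversion H; subst.
    destruct (IHh _ _ H2) as [k1 [N1 R1]]. destruct (IHg _ _ H5) as [k2 [N2 R2]].
    exists (max k1 k2), (max N1 N2). intros f Hf. simpl.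
    rewrite (run_mono h k1 N1 f x y0); [|apply R1; eapply osub_le; [|exact Hf]; lia|lia|lia|apply agree_refl].
    apply (run_mono g k2 N2 f); [apply R2; eapply osub_le; [|exact Hf]; lia|lia|lia|apply agree_refl].
  - inversion H; subst.
    destruct (IHg _ _ H2) as [k1 [N1 R1]]. destruct (IHh _ _ H5) as [k2 [N2 R2]].
    exists (max k1 k2), (max N1 N2). intros f Hf. simpl.
    rewrite (run_mono g k1 N1 f x y0); [|apply R1; eapply osub_le; [|exact Hf]; lia|lia|lia|apply agree_refl].
    rewrite (run_mono h k2 N2 f x z); [|apply R2; eapply osub_le; [|exact Hf]; lia|lia|lia|apply agree_refl].
    reflexivity.
  - assert (K : forall n a y, ev A (CRec g h) (cpair a n) y ->
      exists k N, forall f, osub A N f -> run (CRec g h) k N f (cpair a n) = S y).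
    { clear x y H. induction n as [|n IHn]; intros a y H.
      - inversion H; subst; cpair_eqs; [|discriminate].
        match goal with E : ev A g _ _ |- _ => destruct (IHg _ _ E) as [k [N R]] end.
        exists k, N. intros f Hf. simpl.
        rewrite un1_cpair, un2_cpair. simpl. auto.
      - inversion H; subst; cpair_eqs; [discriminate|].
        match goal with E : S _ = S _ |- _ => injection E as -> end.
        match goal with E : ev A (CRec g h) _ _ |- _ =>
          destruct (IHn _ _ E) as [k1 [N1 R1]] end.
        match goal with E : ev A h _ _ |- _ => destruct (IHh _ _ E) as [k2 [N2 R2]] end.
        exists (max k1 k2), (max N1 N2). intros f Hf.
        assert (R1' : run (CRec g h) (max k1 k2) (max N1 N2) f (cpair a n) = S y0).
        { apply (run_mono _ k1 N1 f); [apply R1; eapply osub_le; [|exact Hf]; lia|lia|lia|apply agree_refl]. }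
        simpl in R1' |- *. rewrite un1_cpair, un2_cpair in R1' |- *. simpl. rewrite R1'.
        apply (run_mono h k2 N2 f); [apply R2; eapply osub_le; [|exact Hf]; lia|lia|lia|apply agree_refl]. }
    rewrite <- (cpair_unpair x) in H |- *. apply K, H.
  - inversion H as [| | | | | | | | | | |f1 x1 n H1 H2]; subst.
    destruct (IHg _ _ H1) as [k1 [N1 R1]].
    (* Common bounds for all values before the zero, collected one value at a time. *)
    assert (K : forall j, j <= y -> exists k N, forall f, osub A N f ->
      forall m, m < j -> 2 <= run g k N f (cpair x m)).
    { induction j as [|j IHj]; intros Hj; [exists 0, 0; intros; lia|].
      destruct (IHj ltac:(lia)) as [k2 [N2 R2]].
      destruct (H2 j ltac:(lia)) as [z [Hz E]]. destruct (IHg _ _ E) as [k3 [N3 R3]].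
      exists (max k2 k3), (max N2 N3). intros f Hf m Hm.
      destruct (Nat.eq_dec m j) as [->|].
      - rewrite (run_mono g k3 N3 f (cpair x j) z);
          [lia|apply R3; eapply osub_le; [|exact Hf]; lia|lia|lia|apply agree_refl].
      - specialize (R2 f ltac:(eapply osub_le; [|exact Hf]; lia) m ltac:(lia)).
        destruct (run g k2 N2 f (cpair x m)) as [|r] eqn:Er; [lia|].
        rewrite (run_mono g k2 N2 f (cpair x m) r); [exact R2|exact Er|lia|lia|apply agree_refl]. }
    destruct (K y (le_n _)) as [k2 [N2 R2]].
    (* The search inspects only arguments below the fuel, so the fuel must exceed [y]. *)
    exists (S (max y (max k1 k2))), (max N1 N2). intros f Hf. cbn [run].
    rewrite (mustate_found _ y); [reflexivity|lia| |].
    + apply (run_mono g k1 N1 f); [apply R1; eapply osub_le; [|exact Hf]; lia|lia|lia|apply agree_refl].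
    + intros m Hm. specialize (R2 f ltac:(eapply osub_le; [|exact Hf]; lia) m ltac:(lia)).
      destruct (run g k2 N2 f (cpair x m)) as [|r] eqn:Er; [lia|].
      rewrite (run_mono g k2 N2 f (cpair x m) r); [exact R2|exact Er|lia|lia|apply agree_refl].
Qed.

Ltac cb := cbv beta; lazymatch goal with
  | |- cmpm (fun x => Nat.b2n (Nat.testbit (@?a x) (@?b x))) => apply (cmpb_testbit a b)
  | |- cmpm (fun x => Nat.b2n (@?a x && @?b x)) => apply (cmpb_and a b)
  | |- cmpm (fun x => Nat.b2n (@?a x || @?b x)) => apply (cmpb_or a b)
  | |- cmpm (fun x => Nat.b2n (negb (@?a x))) => apply (cmpb_neg a)
  | |- cmpm (fun x => Nat.b2n (@?a x <=? @?b x)) => apply (cmpb_leb a b)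
  | |- cmpm (fun x => Nat.b2n (@?a x <? @?b x)) => apply (cmpb_ltb a b)
  | |- cmpm (fun x => Nat.b2n (@?a x =? @?b x)) => apply (cmpb_eqb a b)
  | |- cmpm (fun x => Nat.b2n (ball (@?b x) (@?P x))) => apply (cmpb_ball b P)
  | |- cmpm (fun x => Nat.b2n (bex (@?b x) (@?P x))) => apply (cmpb_bex b P)
  | |- cmpm (fun x => nsum (@?b x) (@?P x)) => apply (cmp_nsum b P)
  | |- cmpm (fun x => match @?a x with 0 => @?f x | S y => @?g x y end) => apply (cmp_case a f g)
  | |- cmpm (fun x => if @?b x then @?f x else @?g x) => apply (cmp_if b f g)
  | |- cmpm (fun x => nat_rect _ (@?f x) (@?g x) (@?b x)) => apply (cmp_rec f g b)
  | |- cmpm (fun x => Nat.b2n (?h (@?a x) (@?b x) (@?c x) (@?d x))) =>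
      apply (cmp_ap4 (fun u v w z => Nat.b2n (h u v w z)) a b c d); [cknown| | | |]
  | |- cmpm (fun x => Nat.b2n (?h (@?a x) (@?b x) (@?c x))) =>
      apply (cmp_ap3 (fun u v w => Nat.b2n (h u v w)) a b c); [cknown| | |]
  | |- _ => cstep
  end.

Lemma cmp_run e : cmp4 (fun k N v x => run e k N (Nat.testbit v) x).
Proof.
  induction e as [ | | | | | |g IHg h IHh|g IHg h IHh|g IHg h IHh|g IHg]; simpl;
    (* Named this way, the recursive calls are functions of four numbers, which is the form of the
       induction hypotheses that the tactic looks up. *)
    try set (rg := fun k N v x => run g k N (Nat.testbit v) x) in *;
    try set (rh := fun k N v x => run h k N (Nat.testbit v) x) in *.
  1-6: repeat cb.
  - change (cmp4 (fun k N v x => match rh k N v x with 0 => 0 | S y => rg k N v y end)).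
    repeat cb.
  - change (cmp4 (fun k N v x => match rg k N v x with 0 => 0 | S y =>
      match rh k N v x with 0 => 0 | S z => S (cpair y z) end end)).
    repeat cb.
  - change (cmp4 (fun k N v x => nat_rect (fun _ => nat) (rg k N v (un1 x))
      (fun n r => match r with 0 => 0 | S y => rh k N v (cpair (un1 x) (cpair n y)) end) (un2 x))).
    repeat cb.
  - change (cmp4 (fun k N v x => Nat.pred (nat_rect (fun _ => nat) 0 (fun n st =>
      match st with
      | 0 => match rg k N v (cpair x n) with 0 => 1 | S r => match r with 0 => S (S n) | S _ => 0 end end
      | S st' => S st' end) k))).
    repeat cb.
Qed.

(** * Random subsets and three-wise intersecting families *)

Open Scope R_scope.

(** The probability of [K] under n independent fair bits, by conditioning on the first bit. *)
Fixpoint mu (n : nat) (K : list bool -> Prop) : R :=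
  match n with
  | 0%nat => if excluded_middle_informative (K []) then 1 else 0
  | S n => (mu n (fun m => K (true :: m)) + mu n (fun m => K (false :: m))) / 2
  end.

Definition mle (m m' : list bool) : Prop := Forall2 (fun a b => a = true -> b = true) m m'.
Definition downclosed (K : list bool -> Prop) : Prop := forall m m', mle m m' -> K m' -> K m.

(** The number of positions covered by none of the three masks. *)
Fixpoint unc (m1 m2 m3 : list bool) : nat :=
  match m1, m2, m3 with
  | a :: m1, b :: m2, c :: m3 => (if a || b || c then unc m1 m2 m3 else S (unc m1 m2 m3))%nat
  | _, _, _ => 0%nat
  end.

Lemma mu_mono n : forall K K' : list bool -> Prop,
  (forall m, length m = n -> K m -> K' m) -> mu n K <= mu n K'.
Proof.
  induction n as [|n IH]; intros K K' H; simpl.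
  - destruct (excluded_middle_informative (K [])), (excluded_middle_informative (K' [])); try lra.
    exfalso. apply n. now apply H.
  - assert (mu n (fun m => K (true :: m)) <= mu n (fun m => K' (true :: m)))
      by (apply IH; intros m <-; now apply H).
    assert (mu n (fun m => K (false :: m)) <= mu n (fun m => K' (false :: m)))
      by (apply IH; intros m <-; now apply H).
    lra.
Qed.

Lemma mu_nonneg n : forall K, 0 <= mu n K.
Proof.
  induction n as [|n IH]; intros K; simpl.
  - destruct (excluded_middle_informative (K [])); lra.
  - pose proof (IH (fun m => K (true :: m))). pose proof (IH (fun m => K (false :: m))). lra.
Qed.

Lemma mu_True n : mu n (fun _ => True) = 1.
Proof.
  induction n as [|n IH]; simpl.
  - destruct (excluded_middle_informative True); tauto.
  - rewrite IH. lra.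
Qed.

Lemma mu_False n : mu n (fun _ => False) = 0.
Proof.
  induction n as [|n IH]; simpl.
  - destruct (excluded_middle_informative False); tauto.
  - rewrite IH. lra.
Qed.

Lemma mu_or n : forall K K', mu n (fun m => K m \/ K' m) <= mu n K + mu n K'.
Proof.
  induction n as [|n IH]; intros K K'; simpl.
  - destruct (excluded_middle_informative (K [] \/ K' [])), (excluded_middle_informative (K [])),
      (excluded_middle_informative (K' [])); try lra; tauto.
  - pose proof (IH (fun m => K (true :: m)) (fun m => K' (true :: m))).
    pose proof (IH (fun m => K (false :: m)) (fun m => K' (false :: m))). simpl in *. lra.
Qed.

Lemma mu_negb n : forall K, mu n (fun m => K (map negb m)) = mu n K.
Proof.
  induction n as [|n IH]; intros K; simpl; [reflexivity|].
  rewrite (IH (fun m => K (false :: m))), (IH (fun m => K (true :: m))). lra.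
Qed.

Lemma mu_lt1 n K : mu n K < 1 -> exists m, length m = n /\ ~ K m.
Proof.
  intros H. apply NNPP. intros C.
  assert (mu n (fun _ => True) <= mu n K); [|rewrite mu_True in *; lra].
  apply mu_mono. intros m Hm _. apply NNPP. intros C'. apply C. eauto.
Qed.

(** The left side is convex in u, and the bound holds at both ends: 125/512 is below 1/4, and at 1
    there is equality. *)
Lemma cube_mean u : 1 / 4 <= u <= 1 -> ((1 + u) / 2) ^ 3 <= u.
Proof. intros H. nra. Qed.

(** If B = b1 b2 b3 is at most y, monotonicity suffices. Otherwise u = y / B lies between 1/4 and 1,
    each ai is at most u bi, and the product of the means is at most ((1 + u) / 2)^3 B, which
    [cube_mean] bounds by u B = y. *)
Lemma product_step (a1 a2 a3 b1 b2 b3 y : R) :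
  0 <= a1 <= b1 -> 0 <= a2 <= b2 -> 0 <= a3 <= b3 -> 0 < y ->
  b1 * b2 * b3 <= 4 * y -> a1 * b2 * b3 <= y -> b1 * a2 * b3 <= y -> b1 * b2 * a3 <= y ->
  (a1 + b1) / 2 * ((a2 + b2) / 2) * ((a3 + b3) / 2) <= y.
Proof.
  intros H1 H2 H3 Hy HB E1 E2 E3. set (B := b1 * b2 * b3) in *.
  assert (HM : forall x1 x2 x3 y1 y2 y3, 0 <= x1 <= y1 -> 0 <= x2 <= y2 -> 0 <= x3 <= y3 ->
    x1 * x2 * x3 <= y1 * y2 * y3).
  { intros. apply Rmult_le_compat; try lra; [nra|]. apply Rmult_le_compat; lra. }
  destruct (Rle_dec B y) as [L|L].
  - apply Rle_trans with B; [|exact L]. apply HM; lra.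
  - assert (0 < B) by lra.
    assert (0 < b1 /\ 0 < b2 /\ 0 < b3).
    { unfold B in *. split; [|split]; apply Rnot_le_lt; intros C.
      - assert (b1 = 0) by lra. subst. lra.
      - assert (b2 = 0) by lra. subst. lra.
      - assert (b3 = 0) by lra. subst. lra. }
    set (u := y / B).
    assert (Hu : u * B = y) by (unfold u; field; lra).
    assert (1 / 4 <= u <= 1) by (split; nra).
    assert (F1 : a1 <= u * b1).
    { apply Rmult_le_reg_r with (b2 * b3); [nra|].
      replace (u * b1 * (b2 * b3)) with (u * B) by (unfold B; ring). lra. }
    assert (F2 : a2 <= u * b2).
    { apply Rmult_le_reg_r with (b1 * b3); [nra|].
      replace (u * b2 * (b1 * b3)) with (u * B) by (unfold B; ring). lra. }
    assert (F3 : a3 <= u * b3).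
    { apply Rmult_le_reg_r with (b1 * b2); [nra|].
      replace (u * b3 * (b1 * b2)) with (u * B) by (unfold B; ring). lra. }
    apply Rle_trans with ((1 + u) / 2 * b1 * ((1 + u) / 2 * b2) * ((1 + u) / 2 * b3)).
    + apply HM; lra.
    + replace ((1 + u) / 2 * b1 * ((1 + u) / 2 * b2) * ((1 + u) / 2 * b3))
        with (((1 + u) / 2) ^ 3 * B) by (unfold B; field).
      rewrite <- Hu. apply Rmult_le_compat_r; [lra|]. now apply cube_mean.
Qed.

Lemma downclosed_cons K b : downclosed K -> downclosed (fun m => K (b :: m)).
Proof. intros H m m' L. apply H. now constructor. Qed.

Lemma mu_cons_le n K : downclosed K -> mu n (fun m => K (true :: m)) <= mu n (fun m => K (false :: m)).
Proof.
  intros H. apply mu_mono. intros m _. apply H. constructor; [discriminate|].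
  induction m; constructor; auto.
Qed.

(** A product bound for cross-intersecting families, stated through complements. Induction on n
    conditions on the three first bits, and [product_step] combines the cases; downward closure
    makes the probability after [false] the larger one. *)
Lemma mu_cross n : forall (K1 K2 K3 : list bool -> Prop) j,
  downclosed K1 -> downclosed K2 -> downclosed K3 ->
  (forall m1 m2 m3, length m1 = n -> length m2 = n -> length m3 = n ->
     K1 m1 -> K2 m2 -> K3 m3 -> (j <= unc m1 m2 m3)%nat) ->
  mu n K1 * mu n K2 * mu n K3 <= (1 / 4) ^ j.
Proof.
  induction n as [|n IH]; intros K1 K2 K3 j D1 D2 D3 H; simpl mu.
  - destruct (excluded_middle_informative (K1 [])), (excluded_middle_informative (K2 [])),
      (excluded_middle_informative (K3 []));
      try (rewrite ?Rmult_0_r, ?Rmult_0_l; apply pow_le; lra).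
    assert (j = 0)%nat by (specialize (H [] [] [] eq_refl eq_refl eq_refl k k0 k1); simpl in H; lia).
    subst. simpl. lra.
  (* Three false bits leave the first position uncovered, so only j - 1 further ones are guaranteed
     and the bound grows by a factor 4. *)
  - assert (B : mu n (fun m => K1 (false :: m)) * mu n (fun m => K2 (false :: m)) *
                mu n (fun m => K3 (false :: m)) <= 4 * (1 / 4) ^ j).
    { destruct j as [|j].
      - apply Rle_trans with ((1 / 4) ^ 0); [|simpl; lra].
        apply IH; auto using downclosed_cons. intros. lia.
      - replace (4 * (1 / 4) ^ S j) with ((1 / 4) ^ j) by (simpl; field).
        apply IH; auto using downclosed_cons. intros m1 m2 m3 L1 L2 L3 k1 k2 k3.
        assert (S j <= unc (false :: m1) (false :: m2) (false :: m3))%nat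
          by (apply H; simpl; auto). simpl in *. lia. }
    (* If some first bit is true, all j uncovered positions lie in the tails. *)
    assert (G : forall b1 b2 b3, b1 || b2 || b3 = true ->
      mu n (fun m => K1 (b1 :: m)) * mu n (fun m => K2 (b2 :: m)) * mu n (fun m => K3 (b3 :: m))
        <= (1 / 4) ^ j).
    { intros b1 b2 b3 Hb. apply IH; auto using downclosed_cons. intros m1 m2 m3 L1 L2 L3 k1 k2 k3.
      assert (j <= unc (b1 :: m1) (b2 :: m2) (b3 :: m3))%nat by (apply H; simpl; auto).
      simpl in *. now rewrite Hb in *. }
    apply product_step; try (split; [apply mu_nonneg|now apply mu_cons_le]).
    + apply pow_lt. lra.
    + exact B.
    + now apply G.
    + now apply G.
    + now apply G.
Qed.

Fixpoint trues (m : list bool) : nat :=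
  match m with [] => 0 | b :: m => (Nat.b2n b + trues m)%nat end.

Lemma trues_negb m : (trues m + trues (map negb m) = length m)%nat.
Proof. induction m as [|[] m IH]; simpl; lia. Qed.

(** A mask or its complement has at most half of its bits true, and complementing preserves the
    probability. *)
Lemma mu_half n : 1 / 2 <= mu n (fun m => (2 * trues m <= n)%nat).
Proof.
  set (K := fun m => (2 * trues m <= n)%nat).
  assert (H : mu n (fun _ => True) <= mu n (fun m => K m \/ K (map negb m))).
  { apply mu_mono. unfold K. intros m Hm _. pose proof (trues_negb m). lia. }
  rewrite mu_True in H.
  pose proof (mu_or n K (fun m => K (map negb m))) as H'.
  rewrite mu_negb in H'. lra.
Qed.

Lemma pow_gt_double p : (2 * p < 4 ^ S p)%nat.
Proof. induction p as [|p IH]; simpl in *; lia. Qed.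

(** By [mu_cross] with three equal families, the cube of each probability is at most 4^(-3(p+1)),
    where p is the number of families. All p families together then have probability below 1/2,
    which leaves room for a mask from [mu_half]. *)
Lemma exists_small_mask n (Ks : list (list bool -> Prop)) (j : nat) :
  (3 * S (length Ks) <= j)%nat ->
  (forall K, In K Ks -> downclosed K) ->
  (forall K m1 m2 m3, In K Ks -> length m1 = n -> length m2 = n -> length m3 = n ->
     K m1 -> K m2 -> K m3 -> (j <= unc m1 m2 m3)%nat) ->
  exists m, length m = n /\ (2 * trues m <= n)%nat /\ forall K, In K Ks -> ~ K m.
Proof.
  intros Hj HD HU. set (p := length Ks) in *. set (t := (1 / 4) ^ S p).
  assert (Ht : forall K, In K Ks -> mu n K <= t).
  { intros K HK. apply Rnot_lt_le. intros C.
    assert (mu n K * mu n K * mu n K <= (1 / 4) ^ (3 * S p)).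
    { apply mu_cross; auto. intros. apply Nat.le_trans with j; [exact Hj|]. eapply HU; eauto. }
    assert (0 < t) by (unfold t; apply pow_lt; lra).
    assert (E : (1 / 4) ^ (3 * S p) = t * t * t).
    { rewrite Nat.mul_comm, pow_mult. fold t. ring. }
    rewrite E in H.
    assert (t * t < mu n K * mu n K) by nra. nra. }
  assert (HS : forall L, (forall K, In K L -> mu n K <= t) ->
    mu n (fun m => exists K, In K L /\ K m) <= INR (length L) * t).
  { induction L as [|K L IH]; intros HL.
    - apply Rle_trans with (mu n (fun _ => False)); [|rewrite mu_False; simpl; lra].
      apply mu_mono. intros m _ [K [[] _]].
    - apply Rle_trans with (mu n (fun m => K m \/ exists K, In K L /\ K m)).
      + apply mu_mono. intros m _ [K' [[->|HK'] HK]]; eauto.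
      + eapply Rle_trans; [apply mu_or|]. simpl length. rewrite S_INR.
        assert (mu n K <= t) by (apply HL; now left).
        assert (mu n (fun m => exists K, In K L /\ K m) <= INR (length L) * t)
          by (apply IH; intros; apply HL; now right).
        lra. }
  specialize (HS Ks Ht). fold p in HS.
  assert (Hpt : INR p * t < 1 / 2).
  { unfold t. replace (1 / 4) with (/ 4) by lra. rewrite pow_inv.
    pose proof (pow_gt_double p) as Hp. apply lt_INR in Hp. rewrite mult_INR, pow_INR in Hp.
    replace (INR 4) with 4 in Hp by (simpl; lra). simpl (INR 2) in Hp.
    assert (0 < 4 ^ S p) by (apply pow_lt; lra).
    apply Rmult_lt_reg_r with (4 ^ S p); [assumption|].
    rewrite Rmult_assoc, Rinv_l by lra. lra. }
  destruct (mu_lt1 n (fun m => ~ (2 * trues m <= n)%nat \/ exists K, In K Ks /\ K m)) as [m [Hm Hn]].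
  - assert (Hc : mu n (fun m => ~ (2 * trues m <= n)%nat) + mu n (fun m => (2 * trues m <= n)%nat) <= 1).
    { clear. assert (Q : forall n K, mu n (fun m => ~ K m) + mu n K = 1).
      { clear. induction n as [|n IH]; intros K; simpl.
        - destruct (excluded_middle_informative (K [])), (excluded_middle_informative (~ K []));
            try lra; tauto.
        - pose proof (IH (fun m => K (true :: m))). pose proof (IH (fun m => K (false :: m))).
          simpl in *. lra. }
      rewrite Q. lra. }
    pose proof (mu_half n). eapply Rle_lt_trans; [apply mu_or|]. lra.
  - exists m. split; [exact Hm|]. split.
    + apply NNPP. tauto.
    + intros K HK C. apply Hn. right. eauto.
Qed.

Fixpoint sel {Y} (C : list Y) (m : list bool) : list Y :=
  match C, m with
  | y :: C, b :: m => if b then y :: sel C m else sel C m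
  | _, _ => []
  end.

(** The entries at the positions counted by [unc]. *)
Fixpoint rest {Y} (C : list Y) (m1 m2 m3 : list bool) : list Y :=
  match C, m1, m2, m3 with
  | y :: C, a :: m1, b :: m2, c :: m3 => if a || b || c then rest C m1 m2 m3 else y :: rest C m1 m2 m3
  | _, _, _, _ => []
  end.

Lemma length_sel {Y} (C : list Y) : forall m, length m = length C -> length (sel C m) = trues m.
Proof.
  induction C as [|y C IH]; intros [|b m] H; simpl in *; try discriminate; [reflexivity|].
  destruct b; simpl; rewrite IH; lia.
Qed.

Lemma sel_mle {Y} (C : list Y) m m' : mle m m' -> incl (sel C m) (sel C m').
Proof.
  intros H. revert C. induction H as [|a b m m' Hab H IH]; intros [|y C] s Hs; simpl in *; try contradiction.
  destruct a.
  - rewrite (Hab eq_refl). destruct Hs as [->|Hs]; [now left|right; now apply IH].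
  - destruct b; [right|]; now apply IH.
Qed.

Lemma length_rest {Y} (C : list Y) : forall m1 m2 m3,
  length m1 = length C -> length m2 = length C -> length m3 = length C ->
  length (rest C m1 m2 m3) = unc m1 m2 m3.
Proof.
  induction C as [|y C IH]; intros [|a m1] [|b m2] [|c m3] H1 H2 H3; simpl in *; try discriminate;
    [reflexivity|].
  destruct (a || b || c); simpl; rewrite IH; lia.
Qed.

Lemma in_rest {Y} (C : list Y) s : forall m1 m2 m3,
  length m1 = length C -> length m2 = length C -> length m3 = length C -> In s C ->
  In s (sel C m1) \/ In s (sel C m2) \/ In s (sel C m3) \/ In s (rest C m1 m2 m3).
Proof.
  induction C as [|y C IH]; intros [|a m1] [|b m2] [|c m3] H1 H2 H3 Hs; simpl in *; try discriminate;
    [contradiction|].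
  destruct Hs as [->|Hs].
  - destruct a; [left; now left|]. destruct b; [right; left; now left|].
    destruct c; [right; right; left; now left|]. right; right; right. now left.
  - destruct (IH m1 m2 m3 ltac:(lia) ltac:(lia) ltac:(lia) Hs) as [H|[H|[H|H]]].
    + left. destruct a; [now right|assumption].
    + right; left. destruct b; [now right|assumption].
    + right; right; left. destruct c; [now right|assumption].
    + right; right; right. destruct (a || b || c); [assumption|now right].
Qed.

Definition union (f g : nat -> bool) : nat -> bool := fun x => f x || g x.
Definition diff (f g : nat -> bool) : nat -> bool := fun x => f x && negb (g x).

(* An index [i] whose labels can be cut down to fewer than [j] by some [E] of
   cost at most [3 V i] is served by those few labels: no [E'] of cost at most
   [V i] excludes all of them, since [E] and [E'] together cost at most [4 V i]. *)
Lemma half_of_labels {I Y} (Is : list I) (C : list Y) (cost : I -> (nat -> bool) -> R)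
    (V : I -> R) (Rl : I -> (nat -> bool) -> Y -> Prop) (p j : nat) :
  p = length Is -> j = (3 * S p)%nat ->
  (forall i E E', cost i (union E E') <= cost i E + cost i E') ->
  (forall i E s, In i Is -> Rl i E s -> In s C) ->
  (forall i E E' s, Rl i (union E E') s -> Rl i E s /\ Rl i E' s) ->
  (forall i E, In i Is -> cost i E <= 4 * V i -> exists s, Rl i E s) ->
  exists J, (2 * length J <= length C + 2 * (p * j))%nat /\
    forall i E, In i Is -> cost i E <= V i -> exists s, In s J /\ Rl i E s.
Proof.
  intros Hp Hj Hc HC Hu Hex.
  set (few := fun i => exists E S, cost i E <= 3 * V i /\ (length S < j)%nat /\
                          forall s, Rl i E s -> In s S).
  set (killed := fun i m => ~ few i /\ exists E, cost i E <= V i /\ forall s, In s (sel C m) -> ~ Rl i E s).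
  (* Collects the short label lists of all indices satisfying [few], at most j labels for each. *)
  assert (HL : forall L, incl L Is -> exists J, (length J <= length L * j)%nat /\
    forall i E, In i L -> few i -> cost i E <= V i -> exists s, In s J /\ Rl i E s).
  { induction L as [|i L IH]; intros HL.
    - exists []. split; [simpl; lia|]. intros i E [].
    - destruct IH as [J [H1 H2]]; [intros x Hx; apply HL; now right|].
      destruct (classic (few i)) as [[E3 [S [F1 [F2 F3]]]]|F].
      + exists (S ++ J). split; [rewrite length_app; simpl; lia|].
        intros i' E [<-|Hi] Hf HE.
        * destruct (Hex i (union E E3)) as [s Hs].
          { apply HL. now left. }
          { specialize (Hc i E E3). lra. }
          apply Hu in Hs. exists s. split; [apply in_or_app; left; apply F3; tauto|tauto].
        * destruct (H2 i' E Hi Hf HE) as [s [Hs1 Hs2]]. exists s. split; [apply in_or_app; tauto|tauto].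
      + exists J. split; [simpl; lia|]. intros i' E [<-|Hi] Hf HE; [contradiction|eauto]. }
  destruct (HL Is (incl_refl _)) as [J0 [HJ0 HJ1]].
  destruct (exists_small_mask (length C) (map killed Is) j) as [m [Hm [Ht Hk]]].
  - rewrite length_map. lia.
  (* An obstruction that excludes the labels of a mask also excludes those of any smaller mask. *)
  - intros K HK. apply in_map_iff in HK. destruct HK as [i [<- Hi]].
    intros m m' L [F [E [HE H]]]. split; [exact F|]. exists E. split; [exact HE|].
    intros s Hs. apply H. exact (sel_mle C m m' L s Hs).
  - intros K m1 m2 m3 HK L1 L2 L3. apply in_map_iff in HK. destruct HK as [i [<- Hi]].
    intros [F [E1 [HE1 H1]]] [_ [E2 [HE2 H2]]] [_ [E3 [HE3 H3]]].
    (* If three killed masks left fewer than j labels uncovered, the union of their obstructions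
       would allow only those labels and so witness [few i]. *)
    apply Nat.nlt_ge. intros Hlt. apply F.
    exists (union E1 (union E2 E3)), (rest C m1 m2 m3). split; [|split].
    + pose proof (Hc i E1 (union E2 E3)). pose proof (Hc i E2 E3). lra.
    + now rewrite length_rest.
    + intros s Hs. pose proof (HC _ _ _ Hi Hs) as HsC.
      apply Hu in Hs. destruct Hs as [Hs1 Hs]. apply Hu in Hs. destruct Hs as [Hs2 Hs3].
      destruct (in_rest C s m1 m2 m3 L1 L2 L3 HsC) as [H|[H|[H|H]]]; [| | |exact H]; exfalso.
      * exact (H1 s H Hs1).
      * exact (H2 s H Hs2).
      * exact (H3 s H Hs3).
  - exists (sel C m ++ J0). split.
    + rewrite length_app, length_sel by exact Hm. rewrite <- Hp in HJ0. lia.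
    + intros i E Hi HE. destruct (classic (few i)) as [F|F].
      * destruct (HJ1 i E Hi F HE) as [s [H1 H2]]. exists s. split; [apply in_or_app; tauto|tauto].
      * apply NNPP. intros C'. apply (Hk (killed i)); [now apply in_map|].
        split; [exact F|]. exists E. split; [exact HE|]. intros s Hs HR. apply C'.
        exists s. split; [apply in_or_app; tauto|exact HR].
Qed.

(** * Weights *)

Definition w (x : nat) : R := (/ 2) ^ un1 x.

Fixpoint wt (f : nat -> bool) (a b : nat) : R :=
  match b with
  | 0%nat => 0
  | S b => wt f a b + (if (a <=? b)%nat && f b then w b else 0)
  end.

Definition sub_on (a b : nat) (f g : nat -> bool) : Prop :=
  forall x, (a <= x < b)%nat -> f x = true -> g x = true.

Lemma w_pos x : 0 < w x.
Proof. apply pow_lt. lra. Qed.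

Lemma wt_le_sum f g h a b :
  (forall x, (a <= x < b)%nat -> f x = true -> g x = true \/ h x = true) ->
  wt f a b <= wt g a b + wt h a b.
Proof.
  induction b as [|b IH]; intros H; simpl; [lra|].
  assert (wt f a b <= wt g a b + wt h a b) by (apply IH; intros; apply H; auto; lia).
  pose proof (w_pos b).
  destruct (Nat.leb_spec a b); simpl; [|lra].
  specialize (H b ltac:(lia)). destruct (f b), (g b), (h b); try lra;
    destruct (H eq_refl); discriminate.
Qed.

Lemma wt_le f g a b : sub_on a b f g -> wt f a b <= wt g a b.
Proof.
  induction b as [|b IH]; intros H; simpl; [lra|].
  assert (wt f a b <= wt g a b) by (apply IH; intros x Hx; apply H; lia).
  pose proof (w_pos b).
  destruct (Nat.leb_spec a b); simpl; [|lra].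
  specialize (H b ltac:(lia)). destruct (f b), (g b); try lra; discriminate (H eq_refl).
Qed.

Lemma wt_nonneg f a b : 0 <= wt f a b.
Proof.
  induction b as [|b IH]; simpl; [lra|].
  pose proof (w_pos b). destruct ((a <=? b)%nat && f b); lra.
Qed.

Lemma wt_empty f a b : (b <= a)%nat -> wt f a b = 0.
Proof.
  induction b as [|b IH]; intros H; simpl; [reflexivity|].
  rewrite IH by lia. destruct (Nat.leb_spec a b); [lia|]. simpl. lra.
Qed.

Lemma wt_chasles f a b c : (a <= b <= c)%nat -> wt f a c = wt f a b + wt f b c.
Proof.
  induction c as [|c IH]; intros H.
  - rewrite (wt_empty f b 0), (wt_empty f a b) by lia. simpl. lra.
  - destruct (Nat.eq_dec b (S c)) as [->|].
    + rewrite (wt_empty f (S c) (S c)) by lia. lra.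
    + simpl. rewrite IH by lia. destruct (Nat.leb_spec a c), (Nat.leb_spec b c); try lia. simpl. lra.
Qed.

Lemma wt_mono_r f a b c : (b <= c)%nat -> wt f a b <= wt f a c.
Proof.
  intros H. destruct (le_lt_dec a b).
  - rewrite (wt_chasles f a b c) by lia. pose proof (wt_nonneg f b c). lra.
  - rewrite wt_empty by lia. apply wt_nonneg.
Qed.

Lemma wt_none f a b : (forall x, (a <= x < b)%nat -> f x = false) -> wt f a b = 0.
Proof.
  intros H. apply Rle_antisym; [|apply wt_nonneg].
  apply Rle_trans with (wt (fun _ => false) a b).
  - apply wt_le. intros x Hx E. rewrite H in E by exact Hx. discriminate.
  - clear. induction b as [|b IH]; simpl; [lra|]. rewrite andb_false_r. lra.
Qed.

Lemma diff_true f g x : diff f g x = true <-> f x = true /\ g x = false.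
Proof. unfold diff. destruct (f x), (g x); simpl; intuition discriminate. Qed.
Lemma union_true f g x : union f g x = true <-> f x = true \/ g x = true.
Proof. unfold union. apply orb_true_iff. Qed.

(** * Convergence on finite oracles *)

(** In the terms of the overview, [s] is a label of the oracle string obtained by cutting [f] at
    [N]. One fuel bound serves all its bits. *)
Definition conv (e : code) (N : nat) (f : nat -> bool) (s : list bool) : Prop :=
  exists k, forall x, (x < length s)%nat -> run e k N f x = S (Nat.b2n (nth x s false)).

Lemma conv_nil e N f : conv e N f [].
Proof. exists 0%nat. simpl. lia. Qed.

Lemma conv_mono e N f N' f' s : conv e N f s -> (N <= N')%nat -> agree N f f' -> conv e N' f' s.
Proof. intros [k H] L A. exists k. intros x Hx. eapply run_mono; eauto. Qed.

Lemma conv_prefix e N f t s :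
  conv e N f t -> conv e N f s -> (length t <= length s)%nat -> exists u, s = t ++ u.
Proof.
  intros [k H] [k' H'] L. exists (skipn (length t) s).
  rewrite <- (firstn_skipn (length t) s) at 1. f_equal.
  apply nth_ext with false false; [rewrite length_firstn; lia|].
  rewrite length_firstn. intros x Hx. rewrite nth_firstn.
  destruct (Nat.ltb_spec x (length t)); [|lia].
  specialize (H x ltac:(lia)). specialize (H' x ltac:(lia)).
  pose proof (run_mono e k N f x _ (max k k') N f H ltac:(lia) ltac:(lia) (agree_refl N f)) as E.
  rewrite (run_mono e k' N f x _ (max k k') N f H' ltac:(lia) ltac:(lia) (agree_refl N f)) in E.
  injection E as E. destruct (nth x s false), (nth x t false); simpl in E; congruence.
Qed.

(** * Small label sets that are hit above every small obstruction *)

(** No extension of the condition given by [sg], [N0], [D] and [beta] forces partiality. The budget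
    is split into [u] for the stem [tau], [v] for the newly promised set [E], and [eta], which
    remains. *)
Definition nonpartial (e : code) (sg : nat -> bool) (N0 : nat) (D : nat -> bool) (beta : R) : Prop :=
  forall N tau E n u v eta,
    (N0 <= N)%nat -> agree N0 sg tau -> sub_on N0 N D tau -> wt (diff tau D) N0 N <= u ->
    (forall L, wt (diff E D) N L <= v) -> 0 < eta -> u + v + eta <= beta ->
    exists M rho s, (N <= M)%nat /\ agree N tau rho /\ sub_on N M D rho /\ sub_on N M E rho /\
      wt (diff rho (union D E)) N M <= eta /\ length s = n /\ conv e M rho s.

(** The conclusion of [nonpartial] with one length [M] for all obstructions [E]. *)
Definition unif e D N tau V h n M : Prop :=
  forall E, wt (diff E D) N M <= V ->
    exists rho s, agree N tau rho /\ sub_on N M D rho /\ sub_on N M E rho /\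
      wt (diff rho (union D E)) N M <= h /\ length s = n /\ conv e M rho s.

(** The hypotheses make [B] an infinite binary tree, as [B L f] depends only on [f] below [L]. The
    branch runs through the nodes, described by [Q], that have extensions on every level. *)
Lemma koenig (B : nat -> (nat -> bool) -> Prop) :
  (forall L f g, agree L f g -> B L f -> B L g) ->
  (forall L M f, (L <= M)%nat -> B M f -> B L f) ->
  (forall L, exists f, B L f) -> exists f, forall L, B L f.
Proof.
  intros Hext Hpre Hex.
  set (Q := fun L f => forall M, exists g, agree L g f /\ B M g).
  set (upd := fun (f : nat -> bool) L b x => if (x =? L)%nat then b else f x).
  assert (Hs : forall L f, Q L f -> Q (S L) (upd f L true) \/ Q (S L) (upd f L false)).
  { intros L f HQ. apply NNPP. intros C. apply not_or_and in C. destruct C as [C1 C2].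
    apply not_all_ex_not in C1. destruct C1 as [M1 C1].
    apply not_all_ex_not in C2. destruct C2 as [M2 C2].
    destruct (HQ (max M1 M2)) as [g [Hg HB]].
    assert (HA : agree (S L) g (upd f L (g L))).
    { intros x Hx. unfold upd. destruct (Nat.eqb_spec x L) as [->|]; [reflexivity|]. apply Hg. lia. }
    destruct (g L).
    - apply C1. exists g. split; [exact HA|]. eapply Hpre; [|exact HB]. lia.
    - apply C2. exists g. split; [exact HA|]. eapply Hpre; [|exact HB]. lia. }
  set (F := nat_rect (fun _ => nat -> bool) (fun _ => false)
    (fun L f => upd f L (if excluded_middle_informative (Q (S L) (upd f L true)) then true else false))).
  assert (HF : forall L, Q L (F L)).
  { induction L as [|L IH].
    - intros M. destruct (Hex M) as [g Hg]. exists g. split; [intros x Hx; lia|exact Hg].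
    - simpl. destruct (excluded_middle_informative (Q (S L) (upd (F L) L true))) as [H|H];
        [exact H|]. destruct (Hs L (F L) IH); [contradiction|assumption]. }
  assert (HA : forall L x, (x < L)%nat -> F L x = F (S x) x).
  { induction L as [|L IH]; intros x Hx; [lia|].
    destruct (Nat.eq_dec x L) as [->|]; [reflexivity|].
    simpl F at 1. unfold upd at 1. destruct (Nat.eqb_spec x L); [lia|]. apply IH. lia. }
  exists (fun x => F (S x) x). intros L. destruct (HF L L) as [g [Hg HB]].
  apply Hext with g; [|exact HB]. intros x Hx. rewrite Hg by exact Hx. now apply HA.
Qed.

(** If no length served all obstructions, those not yet met at length [L] would form an infinite
    tree. A branch would be an [E] of cost at most [V] that is never met, contrary to
    [nonpartial]. *)
Lemma unif_compact e sg N0 D beta N tau u V h n :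
  nonpartial e sg N0 D beta ->
  (N0 <= N)%nat -> agree N0 sg tau -> sub_on N0 N D tau -> wt (diff tau D) N0 N <= u ->
  0 <= V -> 0 < h -> u + V + h <= beta ->
  exists M0, forall M, (M0 <= M)%nat -> unif e D N tau V h n M.
Proof.
  intros HNP HN Hag Hsub Hu HV Hh Hb.
  set (good := fun L E => (N <= L)%nat /\ exists rho s, agree N tau rho /\ sub_on N L D rho /\
    sub_on N L E rho /\ wt (diff rho (union D E)) N L <= h /\ length s = n /\ conv e L rho s).
  assert (Hmono : forall L M E, (L <= M)%nat -> good L E -> good M E).
  { intros L M E HL [HNL [rho [s [A [S1 [S2 [W [Ls Cv]]]]]]]]. split; [lia|].
    (* Beyond [L] exactly the required elements are added, which creates no further excess. *)
    exists (fun x => if (x <? L)%nat then rho x else union D E x), s.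
    split; [|split; [|split; [|split; [|split]]]].
    - intros x Hx. destruct (Nat.ltb_spec x L); [|lia]. apply A, Hx.
    - intros x Hx Hd. destruct (Nat.ltb_spec x L); [apply S1; [lia|exact Hd]|].
      apply union_true. now left.
    - intros x Hx Hd. destruct (Nat.ltb_spec x L); [apply S2; [lia|exact Hd]|].
      apply union_true. now right.
    - rewrite (wt_chasles _ N L M) by lia. rewrite (wt_none _ L M).
      + rewrite Rplus_0_r. eapply Rle_trans; [|exact W]. apply wt_le. intros x Hx Hd.
        apply diff_true in Hd. apply diff_true. destruct (Nat.ltb_spec x L); [exact Hd|lia].
      + intros x Hx. unfold diff. destruct (Nat.ltb_spec x L); [lia|]. now destruct (union D E x).
    - exact Ls.
    - eapply conv_mono; [exact Cv|exact HL|]. intros x Hx. destruct (Nat.ltb_spec x L); [reflexivity|lia]. }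
  destruct (classic (exists L, forall E, wt (diff E D) N L <= V -> good L E)) as [[L HL]|C].
  - exists L. intros M HM E HE. apply (Hmono L M E HM). apply HL.
    eapply Rle_trans; [|exact HE]. now apply wt_mono_r.
  - exfalso.
    destruct (koenig (fun L E => wt (diff E D) N L <= V /\ ~ good L E)) as [E HE].
    + intros L f g Hfg [H1 H2]. split.
      * eapply Rle_trans; [|exact H1]. apply wt_le. intros x Hx. rewrite !diff_true.
        rewrite Hfg by lia. auto.
      * intros [HNL [rho [s [A [S1 [S2 [W [Ls Cv]]]]]]]]. apply H2. split; [exact HNL|].
        exists rho, s. split; [exact A|]. split; [exact S1|]. split; [|split; [|split; [exact Ls|exact Cv]]].
        -- intros x Hx Hd. apply S2; [exact Hx|]. rewrite <- Hfg by lia. exact Hd.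
        -- eapply Rle_trans; [|exact W]. apply wt_le. intros x Hx. rewrite !diff_true.
           unfold union. rewrite Hfg by lia. auto.
    + intros L M f HL [H1 H2]. split.
      * eapply Rle_trans; [|exact H1]. now apply wt_mono_r.
      * intros G. apply H2. now apply (Hmono L M).
    + intros L. apply not_ex_all_not with (n := L) in C. apply not_all_ex_not in C.
      destruct C as [E HE]. exists E. now apply imply_to_and in HE.
    + destruct (HNP N tau E n u V h HN Hag Hsub Hu (fun L => proj1 (HE L)) Hh Hb)
        as [M [rho [s [HM H]]]].
      apply (proj2 (HE M)). split; [exact HM|]. exists rho, s. tauto.
Qed.

Fixpoint allstr (d : nat) : list (list bool) :=
  match d with
  | 0%nat => [[]]
  | S d => map (cons true) (allstr d) ++ map (cons false) (allstr d)
  end.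

Lemma length_allstr d : length (allstr d) = (2 ^ d)%nat.
Proof. induction d as [|d IH]; simpl; [reflexivity|]. rewrite length_app, !length_map, IH. lia. Qed.

Lemma length_extensions d (T : list (list bool)) :
  length (flat_map (fun t => map (app t) (allstr d)) T) = (length T * 2 ^ d)%nat.
Proof.
  induction T as [|t T IH]; simpl; [reflexivity|].
  rewrite length_app, length_map, length_allstr, IH. lia.
Qed.

Lemma in_allstr s : In s (allstr (length s)).
Proof.
  induction s as [|[] s IH]; simpl; [now left| |]; apply in_or_app; [left|right]; now apply in_map.
Qed.

(** Oracle strings of length [N] become numbers below 2^N, so that they can be listed and searched
    through. *)
Lemma mask_exists N : forall f, exists v, (v < 2 ^ N)%nat /\ agree N (Nat.testbit v) f.
Proof.
  induction N as [|N IH]; intros f.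
  - exists 0%nat. split; [simpl; lia|]. intros x Hx. lia.
  - destruct (IH (fun x => f (S x))) as [v [Hv Hf]]. exists (2 * v + Nat.b2n (f 0%nat))%nat. split.
    + simpl. destruct (f 0%nat); simpl; lia.
    + intros [|x] Hx; [apply Nat.testbit_0_r|]. rewrite Nat.testbit_succ_r. apply Hf. lia.
Qed.

Lemma common_bound {I} (l : list I) (P : I -> nat -> Prop) :
  (forall i, In i l -> exists M0, forall M, (M0 <= M)%nat -> P i M) ->
  exists M0, forall M, (M0 <= M)%nat -> forall i, In i l -> P i M.
Proof.
  induction l as [|i l IH]; intros H.
  - exists 0%nat. intros M _ i [].
  - destruct IH as [M1 H1]; [intros; apply H; now right|].
    destruct (H i (or_introl eq_refl)) as [M2 H2].
    exists (max M1 M2). intros M HM i' [<-|Hi]; [apply H2; lia|apply H1; [lia|exact Hi]].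
Qed.

(** Rounds a cost up to a multiple of the mesh [h], so that only finitely many cost bounds have to
    be served at once. *)
Lemma grid_below h x K : 0 < h -> 0 <= x -> x <= INR K * h ->
  exists k, (k <= K)%nat /\ x <= INR k * h <= x + h.
Proof.
  intros Hh Hx. induction K as [|K IH]; intros HK.
  - exists 0%nat. simpl in *. split; [lia|]. lra.
  - destruct (Rle_dec x (INR K * h)) as [L|L].
    + destruct (IH L) as [k [Hk1 Hk2]]. exists k. split; [lia|exact Hk2].
    + exists (S K). split; [lia|]. rewrite S_INR in *. lra.
Qed.

Lemma grid_above h x : 0 < h -> 0 <= x -> exists K, x <= INR K * h <= x + h.
Proof.
  intros Hh Hx. destruct (archimed (x / h)) as [A1 A2].
  assert (0 <= x / h) by (apply Rmult_le_pos; [lra|apply Rlt_le, Rinv_0_lt_compat; lra]).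
  assert (Hz : (0 <= up (x / h))%Z) by (apply le_IZR; lra).
  exists (Z.to_nat (up (x / h))). rewrite INR_IZR_INZ, Z2Nat.id by exact Hz.
  assert (E : x / h * h = x) by (field; lra).
  split; nra.
Qed.

(** The state after i halvings. The relative size of [T] is at most (3/4)^i rather than 2^-i, which
    leaves room for the few extra labels of each round. The factor 4 is the one in [half_of_labels],
    and the term growing with i absorbs the accumulated rounding errors. *)
Definition level e sg N0 D eps i : Prop :=
  exists N n T, (N0 <= N)%nat /\ (forall t, In t T -> length t = n) /\
    (length T * 4 ^ i <= 3 ^ i * 2 ^ n)%nat /\
    forall E, wt (diff E D) N0 N <= eps ->
      exists tau, agree N0 sg tau /\ sub_on N0 N D tau /\ sub_on N0 N E tau /\
        wt (diff tau D) N0 N <= 4 * wt (diff E D) N0 N + eps * (1 - (1 / 2) ^ i) /\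
        exists t, In t T /\ conv e N tau t.

(** The labels in [T] are lengthened by d bits and [half_of_labels] picks from these extensions. Its
    indices are pairs of a labelled stem of length [N] and a rounded cost bound for the part of [E]
    beyond [N]. *)
Lemma level_step e sg N0 D beta eps i :
  nonpartial e sg N0 D beta -> 0 < eps -> 16 * eps <= beta ->
  level e sg N0 D eps i -> level e sg N0 D eps (S i).
Proof.
  intros HNP He Hb [N [n [T [HN [HT [Hcnt Hlev]]]]]].
  (* Rounding costs 4 h and the slack in [unif] costs h; the total 5 h is exactly the growth of the
     error term from i to i + 1. *)
  set (h := eps * (1 / 2) ^ i / 10).
  assert (Hi : 0 < (1 / 2) ^ i <= 1).
  { split; [apply pow_lt; lra|]. apply Rle_trans with (1 ^ i); [apply pow_incr; lra|rewrite pow1; lra]. }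
  assert (Hei : 0 < eps * (1 / 2) ^ i <= eps).
  { split; [apply Rmult_lt_0_compat; lra|].
    apply Rle_trans with (eps * 1); [apply Rmult_le_compat_l; lra|lra]. }
  assert (Hh : 0 < h) by (unfold h; lra).
  assert (Hh1 : 10 * h <= eps) by (unfold h; lra).
  destruct (grid_above h eps Hh ltac:(lra)) as [K [HK1 HK2]].
  (* An admissible stem has excess at most 4 eps plus an error below eps, hence at most 5 eps. *)
  set (act := fun v => agree N0 sg (Nat.testbit v) /\ sub_on N0 N D (Nat.testbit v) /\
    wt (diff (Nat.testbit v) D) N0 N <= 5 * eps /\ exists t, In t T /\ conv e N (Nat.testbit v) t).
  set (Is := filter (fun q => if excluded_middle_informative (act (fst q)) then true else false)
    (list_prod (seq 0 (2 ^ N)) (seq 0 (S K)))).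
  assert (HIs : forall q, In q Is <-> (fst q < 2 ^ N)%nat /\ (snd q <= K)%nat /\ act (fst q)).
  { intros [v k]. unfold Is. rewrite filter_In, in_prod_iff, !in_seq. simpl fst. simpl snd.
    destruct (excluded_middle_informative (act v)); intuition (try discriminate; try lia). }
  set (p := length Is). set (j := (3 * S p)%nat).
  (* The number p j of additional labels must be at most a quarter of the new label set. *)
  assert (Hd : exists d, (4 * (p * j) <= 2 ^ d)%nat).
  { exists (4 * (p * j))%nat. pose proof (Nat.pow_gt_lin_r 2 (4 * (p * j))). lia. }
  destruct Hd as [d Hd].
  assert (HV : forall q, In q Is -> 0 <= INR (snd q) * h <= eps + h).
  { intros q Hq. apply HIs in Hq. destruct Hq as [_ [Hk _]]. apply le_INR in Hk.
    pose proof (pos_INR (snd q)). split; nra. }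
  destruct (common_bound Is (fun q M => unif e D N (Nat.testbit (fst q)) (4 * (INR (snd q) * h)) h (n + d) M))
    as [M0 HM0].
  { intros q Hq. pose proof (HV q Hq). apply HIs in Hq. destruct Hq as [_ [_ [A1 [A2 [A3 _]]]]].
    eapply unif_compact; [exact HNP|exact HN|exact A1|exact A2|exact A3| | |]; lra. }
  set (M := max M0 N). specialize (HM0 M ltac:(lia)).
  set (C := flat_map (fun t => map (app t) (allstr d)) T).
  assert (HCl : length C = (length T * 2 ^ d)%nat) by apply length_extensions.
  (* The excess is measured against [D] alone, so that an extension meeting a union of obstructions
     counts for each of them. *)
  set (Rl := fun (q : nat * nat) E s => exists rho, agree N (Nat.testbit (fst q)) rho /\
    sub_on N M D rho /\ sub_on N M E rho /\ wt (diff rho D) N M <= 4 * (INR (snd q) * h) + h /\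
    length s = (n + d)%nat /\ conv e M rho s).
  destruct (half_of_labels Is C (fun _ E => wt (diff E D) N M) (fun q => INR (snd q) * h) Rl p j)
    as [J [HJ1 HJ2]].
  - reflexivity.
  - reflexivity.
  - intros _ E E'. apply wt_le_sum. intros x _ Hx.
    apply diff_true in Hx. rewrite !diff_true. rewrite union_true in Hx. tauto.
  - intros q E s Hq [rho [A [_ [_ [_ [Ls Cv]]]]]]. apply HIs in Hq.
    destruct Hq as [_ [_ [_ [_ [_ [t [Ht Ct]]]]]]].
    destruct (conv_prefix e M rho t s) as [u ->].
    + eapply conv_mono; [exact Ct|unfold M; lia|exact A].
    + exact Cv.
    + rewrite (HT t Ht). lia.
    + unfold C. apply in_flat_map. exists t. split; [exact Ht|]. apply in_map.
      rewrite length_app, (HT t Ht) in Ls. replace d with (length u) by lia. apply in_allstr.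
  - intros q E E' s [rho [A [S1 [S2 [W [Ls Cv]]]]]]. split; exists rho; repeat (split; [assumption|]);
      (split; [intros x Hx Hd'; apply S2; [exact Hx|]; apply union_true; tauto|tauto]).
  - intros q E Hq HE. destruct (HM0 q Hq E HE) as [rho [s [A [S1 [S2 [W [Ls Cv]]]]]]].
    exists s, rho. repeat (split; [assumption|]). split; [|tauto].
    apply Rle_trans with (wt (diff E D) N M + wt (diff rho (union D E)) N M); [|lra].
    apply wt_le_sum. intros x _ Hx. apply diff_true in Hx. rewrite !diff_true.
    unfold union. destruct Hx as [-> ->]. destruct (E x); simpl; tauto.
  (* The length filter is applied because [half_of_labels] does not assert that [J] lies within
     [C]. *)
  - exists M, (n + d)%nat, (filter (fun s => (length s =? n + d)%nat) J).
    split; [unfold M; lia|]. split; [|split].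
    + intros t Ht. apply filter_In in Ht. now apply Nat.eqb_eq.
    (* The empty obstruction yields a label in [T], so [C] has at least 2^d entries and p j is at
       most a quarter of its length. *)
    + assert (Hne : (1 <= length T)%nat).
      { destruct (Hlev (fun _ => false)) as [tau [_ [_ [_ [_ [t [Ht _]]]]]]].
        - rewrite wt_none; [lra|]. reflexivity.
        - destruct T; [contradiction|simpl; lia]. }
      pose proof (filter_length_le (fun s => (length s =? n + d)%nat) J).
      assert (F : (4 * length J <= 3 * (length T * 2 ^ d))%nat) by nia.
      rewrite Nat.pow_add_r. simpl Nat.pow.
      apply Nat.le_trans with (4 * length J * 4 ^ i)%nat; [nia|].
      apply Nat.le_trans with (3 * (length T * 4 ^ i) * 2 ^ d)%nat; [nia|].
      apply Nat.le_trans with (3 * (3 ^ i * 2 ^ n) * 2 ^ d)%nat; [|lia].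
      apply Nat.mul_le_mono_r. lia.
    + intros E HE.
      assert (Hsp : wt (diff E D) N0 M = wt (diff E D) N0 N + wt (diff E D) N M)
        by (apply wt_chasles; unfold M; lia).
      pose proof (wt_nonneg (diff E D) N0 N). pose proof (wt_nonneg (diff E D) N M).
      (* The old label set handles [E] below [N]; the part of [E] beyond [N] is then met above that
         stem, with its cost rounded up to the grid. *)
      destruct (Hlev E) as [tau [A1 [A2 [A3 [A4 [t [Ht Ct]]]]]]]; [lra|].
      destruct (mask_exists N tau) as [v [Hv Hvt]].
      destruct (grid_below h (wt (diff E D) N M) K Hh ltac:(lra) ltac:(lra)) as [k [Hk1 Hk2]].
      destruct (HJ2 (v, k) E) as [s [Hs [rho [B1 [B2 [B3 [B4 [B5 B6]]]]]]]].
      * apply HIs. simpl fst. simpl snd. split; [exact Hv|]. split; [exact Hk1|].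
        split; [|split; [|split]].
        -- intros x Hx. rewrite Hvt by lia. now apply A1.
        -- intros x Hx Hd'. rewrite Hvt by lia. now apply A2.
        -- apply Rle_trans with (wt (diff tau D) N0 N); [|nra].
           apply wt_le. intros x Hx. rewrite !diff_true, Hvt by lia. auto.
        -- exists t. split; [exact Ht|]. eapply conv_mono; [exact Ct|lia|].
           intros x Hx. symmetry. now apply Hvt.
      * simpl snd. lra.
      * simpl fst in B1. simpl snd in B4.
        assert (B : agree N tau rho) by (intros x Hx; rewrite <- Hvt by exact Hx; now apply B1).
        exists rho. split; [|split; [|split; [|split]]].
        -- intros x Hx. rewrite A1 by exact Hx. apply B. lia.
        -- intros x Hx Hd'. destruct (le_lt_dec N x); [apply B2; [lia|exact Hd']|].
           rewrite <- B by lia. apply A2; [lia|exact Hd'].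
        -- intros x Hx Hd'. destruct (le_lt_dec N x); [apply B3; [lia|exact Hd']|].
           rewrite <- B by lia. apply A3; [lia|exact Hd'].
        -- rewrite (wt_chasles (diff rho D) N0 N M) by (unfold M; lia).
           assert (wt (diff rho D) N0 N <= wt (diff tau D) N0 N).
           { apply wt_le. intros x Hx. rewrite !diff_true, B by lia. auto. }
           assert (E5 : eps * (1 - (1 / 2) ^ S i) = eps * (1 - (1 / 2) ^ i) + 5 * h)
             by (unfold h; simpl; field).
           rewrite E5. lra.
        -- exists s. split; [|exact B6]. apply filter_In. split; [exact Hs|]. now apply Nat.eqb_eq.
Qed.

Lemma level_all e sg N0 D beta eps i :
  nonpartial e sg N0 D beta -> 0 < eps -> 16 * eps <= beta -> level e sg N0 D eps i.
Proof.
  intros HNP He Hb. induction i as [|i IH]; [|eapply level_step; eauto].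
  exists N0, 0%nat, [[]]. split; [lia|]. split; [|split].
  - now intros t [<-|[]].
  - simpl. lia.
  - intros E _. exists sg. rewrite !(wt_empty _ N0 N0) by lia. split; [apply agree_refl|].
    split; [intros x Hx; lia|]. split; [intros x Hx; lia|]. split; [simpl; lra|].
    exists []. split; [now left|apply conv_nil].
Qed.

(** * The test attached to a functional *)

Open Scope nat_scope.

(** The weight multiplied by 2^N. It is an integer, since [un1 x] is at most x and x is below
    [N]. *)
Definition wtn (N0 N v : nat) : nat :=
  nsum N (fun x => Nat.b2n ((N0 <=? x) && Nat.testbit v x) * 2 ^ (N - un1 x)).

(* [c] codes a string of length [n] exactly when [2 ^ n <= S c < 2 ^ S n], and the
   bits of that string are then the lowest [n] bits of [S c]. *)
Definition inT (n T c : nat) : bool :=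
  Nat.testbit T c && (2 ^ n <=? S c) && (S c <? 2 ^ S n).
Definition cntT (n T : nat) : nat := nsum (2 ^ S n) (fun c => Nat.b2n (inT n T c)).

(** An index [i] codes a stem, as a bit mask with its length, together with an exponent a standing
    for eps = 2^-a. *)
Definition i_str i := un1 i.
Definition i_len i := un1 (un2 i).
Definition i_exp i := un2 (un2 i).
(** A candidate [z] codes a fuel bound, the length of the extensions, the length of the labels, and
    the label set as a bit mask. *)
Definition z_fuel z := un1 z.
Definition z_dom z := un1 (un2 z).
Definition z_len z := un1 (un2 (un2 z)).
Definition z_set z := un2 (un2 (un2 z)).

Definition hit e (z v : nat) : bool :=
  bex (2 ^ S (z_len z)) (fun c => inT (z_len z) (z_set z) c &&
    ball (z_len z) (fun x => run e (z_fuel z) (z_dom z) (Nat.testbit v) x =?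
                             S (Nat.b2n (Nat.testbit (S c) x)))).

(** The last clause bounds the weight beyond the stem by 8 eps, without fractions. *)
Definition extends (i z E v : nat) : bool :=
  ball (i_len i) (fun x => Nat.b2n (Nat.testbit v x) =? Nat.b2n (Nat.testbit (i_str i) x)) &&
  ball (z_dom z) (fun x => negb ((i_len i <=? x) && Nat.testbit E x) || Nat.testbit v x) &&
  (wtn (i_len i) (z_dom z) v * 2 ^ i_exp i <=? 8 * 2 ^ z_dom z).

(** The promised set does not occur, since it need not be computable. It enters only later, as one
    particular obstruction [E]. *)
Definition big e (i z : nat) : bool :=
  ball (2 ^ z_dom z) (fun E =>
    negb (wtn (i_len i) (z_dom z) E * 2 ^ i_exp i <? 2 ^ z_dom z) ||
    bex (2 ^ z_dom z) (fun v => extends i z E v && hit e z v)).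

Definition chk e (i q z : nat) : bool :=
  (i_len i <=? z_dom z) && (cntT (z_len z) (z_set z) * 2 ^ q <=? 2 ^ z_len z) && big e i z.

(** Taking the least candidate assigns a single label set to each stem and precision, which keeps
    the measure under control. *)
Definition least_chk e (i q z : nat) : bool := chk e i q z && ball z (fun z' => negb (chk e i q z')).

(** Level m receives from index i a set of measure at most 2^-(m+i+1), and these bounds sum to
    2^-m. *)
Definition enumerates e (x u : nat) : bool :=
  least_chk e (un1 u) (un1 x + un1 u + 1) (un2 u) &&
  inT (z_len (un2 u)) (z_set (un2 u)) (un2 x).

Definition test (e : code) (m : nat) (s : list bool) : Prop :=
  exists u, enumerates e (cpair m (strcode s)) u = true.

(** * Computability of the test *)

Lemma cmp_wtn : cmp3 wtn.
Proof. unfold wtn. repeat cb. Qed.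
Lemma cmp_inT : cmp3 (fun n T c => Nat.b2n (inT n T c)).
Proof. unfold inT. repeat cb. Qed.
#[local] Hint Resolve cmp_wtn cmp_inT cmp_run : cmpdb.
Lemma cmp_cntT : cmp2 cntT.
Proof. unfold cntT. repeat cb. Qed.
#[local] Hint Resolve cmp_cntT : cmpdb.
Lemma cmp_hit e : cmp2 (fun z v => Nat.b2n (hit e z v)).
Proof.
  unfold hit, z_len, z_set, z_fuel, z_dom.
  set (r := fun k N v x => run e k N (Nat.testbit v) x).
  assert (Hr : cmp4 r) by apply cmp_run.
  change (cmp2 (fun z v => Nat.b2n (bex (2 ^ S (un1 (un2 (un2 z)))) (fun c =>
    inT (un1 (un2 (un2 z))) (un2 (un2 (un2 z))) c &&
    ball (un1 (un2 (un2 z))) (fun x => r (un1 z) (un1 (un2 z)) v x =?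
      S (Nat.b2n (Nat.testbit (S c) x))))))).
  repeat cb.
Qed.
Lemma cmp_extends : cmp4 (fun i z E v => Nat.b2n (extends i z E v)).
Proof. unfold extends, i_len, i_str, i_exp, z_dom. repeat cb. Qed.
#[local] Hint Resolve cmp_hit cmp_extends : cmpdb.
Lemma cmp_big e : cmp2 (fun i z => Nat.b2n (big e i z)).
Proof.
  unfold big, i_len, i_exp, z_dom. repeat cb.
  apply (cmp_ap2 (fun z v => Nat.b2n (hit e z v))); [apply cmp_hit| |]; cb.
Qed.
Lemma cmp_chk e : cmp3 (fun i q z => Nat.b2n (chk e i q z)).
Proof.
  unfold chk, i_len, z_dom, z_len, z_set. repeat cb.
  apply (cmp_ap2 (fun i z => Nat.b2n (big e i z))); [apply cmp_big| |]; cb.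
Qed.
#[local] Hint Resolve cmp_chk : cmpdb.
Lemma cmp_least_chk e : cmp3 (fun i q z => Nat.b2n (least_chk e i q z)).
Proof.
  unfold least_chk.
  set (c := chk e). assert (Hc : cmp3 (fun i q z => Nat.b2n (c i q z))) by apply cmp_chk.
  clearbody c. repeat cb.
Qed.
Lemma cmp_enumerates e : cmp2 (fun x u => Nat.b2n (enumerates e x u)).
Proof.
  unfold enumerates, z_len, z_set.
  set (c := least_chk e). assert (Hc : cmp3 (fun i q z => Nat.b2n (c i q z))) by apply cmp_least_chk.
  clearbody c. repeat cb.
Qed.

(** * Codes of strings and counting of label sets *)

Lemma strcode_cons b s : S (strcode (b :: s)) = 2 * S (strcode s) + Nat.b2n b.
Proof. simpl. destruct b; simpl; lia. Qed.

Lemma strcode_bounds s : 2 ^ length s <= S (strcode s) < 2 ^ S (length s).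
Proof.
  induction s as [|b s IH]; [simpl; lia|]. rewrite strcode_cons. simpl in *. destruct b; simpl; lia.
Qed.

Lemma strcode_bit s : forall i, i < length s -> Nat.testbit (S (strcode s)) i = nth i s false.
Proof.
  induction s as [|b s IH]; intros i Hi; [simpl in Hi; lia|]. rewrite strcode_cons.
  destruct i as [|i]; [apply Nat.testbit_0_r|]. rewrite Nat.testbit_succ_r. apply IH. simpl in Hi. lia.
Qed.

Lemma strcode_length s n : 2 ^ n <= S (strcode s) < 2 ^ S n -> length s = n.
Proof.
  intros H. pose proof (strcode_bounds s).
  assert (length s < S n) by (apply (Nat.pow_lt_mono_r_iff 2); lia).
  assert (n < S (length s)) by (apply (Nat.pow_lt_mono_r_iff 2); lia). lia.
Qed.

Lemma strcode_inj s t : strcode s = strcode t -> s = t.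
Proof.
  intros E. assert (L : length s = length t).
  { apply strcode_length. rewrite E. apply strcode_bounds. }
  apply nth_ext with false false; [exact L|]. intros i Hi.
  rewrite <- !strcode_bit by lia. now rewrite E.
Qed.

Lemma strcode_surj c : exists s, strcode s = c.
Proof.
  induction c as [c IH] using lt_wf_ind. destruct c as [|c]; [now exists []|].
  pose proof (Nat.div2_odd c) as H.
  destruct (IH (Nat.div2 c)) as [s Hs]; [destruct (Nat.odd c); simpl in H; lia|].
  exists (Nat.odd c :: s). simpl. rewrite Hs. destruct (Nat.odd c); simpl in *; lia.
Qed.

Lemma inT_strcode n T s : inT n T (strcode s) = true <-> Nat.testbit T (strcode s) = true /\ length s = n.
Proof.
  unfold inT. rewrite !andb_true_iff, Nat.leb_le, Nat.ltb_lt. split.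
  - intros [[H1 H2] H3]. split; [exact H1|]. now apply strcode_length.
  - intros [H1 <-]. pose proof (strcode_bounds s). tauto.
Qed.

Lemma nsum_filter n P : nsum n (fun c => Nat.b2n (P c)) = length (filter P (seq 0 n)).
Proof.
  induction n as [|n IH]; [reflexivity|].
  rewrite seq_S, filter_app, length_app. simpl. rewrite IH. destruct (P n); simpl; lia.
Qed.

Lemma length_le_cntT n T l :
  NoDup l -> (forall s, In s l -> inT n T (strcode s) = true) -> length l <= cntT n T.
Proof.
  intros HN H. unfold cntT. rewrite nsum_filter, <- (length_map strcode).
  apply NoDup_incl_length.
  - apply Injective_map_NoDup; [exact strcode_inj|exact HN].
  - intros c Hc. apply in_map_iff in Hc. destruct Hc as [s [<- Hs]].
    apply filter_In. split; [|now apply H]. apply in_seq.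
    specialize (H s Hs). apply inT_strcode in H. destruct H as [_ <-].
    pose proof (strcode_bounds s). lia.
Qed.

Lemma least_chk_unique e i q z z' :
  least_chk e i q z = true -> least_chk e i q z' = true -> z = z'.
Proof.
  unfold least_chk. rewrite !andb_true_iff, !ball_spec. intros [H1 H2] [H1' H2'].
  destruct (Nat.lt_trichotomy z z') as [L|[L|L]]; [|exact L|].
  - specialize (H2' z L). now rewrite H1 in H2'.
  - specialize (H2 z' L). now rewrite H1' in H2.
Qed.

Open Scope R_scope.

(** * Measure of the test *)

Lemma ssum_same_length n l : (forall s, In s l -> length s = n) -> ssum l = INR (length l) * (/ 2) ^ n.
Proof.
  induction l as [|s l IH]; intros H; [simpl; lra|].
  change (ssum (s :: l)) with ((/ 2) ^ length s + ssum l).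
  rewrite IH by (intros; apply H; now right). rewrite (H s) by now left.
  simpl length. rewrite S_INR. lra.
Qed.

Lemma ssum_partition b l : ssum l = ssum (filter b l) + ssum (filter (fun s => negb (b s)) l).
Proof.
  induction l as [|s l IH]; [simpl; lra|].
  change (ssum (s :: l)) with ((/ 2) ^ length s + ssum l). rewrite IH. simpl filter.
  destruct (b s); simpl; lra.
Qed.

(** Splits off the strings that come from the last index. They all lie in the label set of one
    candidate, so they weigh at most 2^-(m+I+1), and the remaining bounds form a geometric sum. *)
Lemma ssum_stages e m I : forall l, NoDup l ->
  (forall s, In s l -> exists i z, (i < I)%nat /\ least_chk e i (m + i + 1) z = true /\
     inT (z_len z) (z_set z) (strcode s) = true) ->
  ssum l <= (/ 2) ^ m * (1 - (/ 2) ^ I).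
Proof.
  induction I as [|I IH]; intros l HN H.
  - destruct l as [|s l]; [simpl; lra|]. destruct (H s (or_introl eq_refl)) as [i [z [Hi _]]]. lia.
  - set (b := fun s => if excluded_middle_informative (exists z, least_chk e I (m + I + 1) z = true /\
       inT (z_len z) (z_set z) (strcode s) = true) then true else false).
    rewrite (ssum_partition b).
    assert (H2 : ssum (filter (fun s => negb (b s)) l) <= (/ 2) ^ m * (1 - (/ 2) ^ I)).
    { apply IH; [now apply NoDup_filter|]. intros s Hs. apply filter_In in Hs. destruct Hs as [Hs Hb].
      destruct (H s Hs) as [i [z [Hi [Hz HT]]]]. exists i, z. split; [|tauto].
      destruct (Nat.eq_dec i I) as [->|]; [|lia]. exfalso. unfold b in Hb.
      destruct (excluded_middle_informative _) as [_|C]; [discriminate|]. apply C. eauto. }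
    assert (H1 : ssum (filter b l) <= (/ 2) ^ (m + I + 1)).
    { assert (Hb : forall s, In s (filter b l) -> exists z, least_chk e I (m + I + 1) z = true /\
        inT (z_len z) (z_set z) (strcode s) = true).
      { intros s Hs. apply filter_In in Hs. destruct Hs as [_ Hs]. unfold b in Hs.
        destruct (excluded_middle_informative _) as [C|]; [exact C|discriminate]. }
      destruct (classic (exists z, least_chk e I (m + I + 1) z = true)) as [[z Hz]|C].
      - assert (Hb' : forall s, In s (filter b l) -> inT (z_len z) (z_set z) (strcode s) = true).
        { intros s Hs. destruct (Hb s Hs) as [z' [Hz' HT]].
          now rewrite (least_chk_unique _ _ _ _ _ Hz Hz'). }
        rewrite (ssum_same_length (z_len z))
          by (intros s Hs; apply Hb', inT_strcode in Hs; tauto).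
        pose proof (length_le_cntT _ _ _ (NoDup_filter b HN) Hb') as HL.
        unfold least_chk, chk in Hz. rewrite !andb_true_iff, Nat.leb_le in Hz.
        destruct Hz as [[[_ Hz] _] _]. rewrite Nat.leb_le in Hz.
        set (q := (m + I + 1)%nat) in *.
        assert (HM : (length (filter b l) * 2 ^ q <= 2 ^ z_len z)%nat) by nia.
        apply le_INR in HM. rewrite mult_INR, !pow_INR in HM. replace (INR 2) with 2 in HM by (simpl; lra).
        rewrite !pow_inv.
        assert (0 < 2 ^ q) by (apply pow_lt; lra). assert (0 < 2 ^ z_len z) by (apply pow_lt; lra).
        apply Rmult_le_reg_r with (2 ^ z_len z); [assumption|].
        rewrite Rmult_assoc, Rinv_l by lra.
        apply Rmult_le_reg_r with (2 ^ q); [assumption|].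
        replace (/ 2 ^ q * 2 ^ z_len z * 2 ^ q) with (2 ^ z_len z) by (field; lra). lra.
      - destruct (filter b l) as [|s l'].
        + simpl. apply pow_le. lra.
        + destruct (Hb s (or_introl eq_refl)) as [z [Hz _]]. exfalso. eauto. }
    rewrite !pow_add in H1. simpl pow in *. nra.
Qed.

Lemma ML_test_test e : ML_test (test e).
Proof.
  split.
  - destruct (ce_search (enumerates e) (cmp_enumerates e)) as [c Hc]. exists c. intros x.
    rewrite <- Hc. split.
    + intros [n [s [-> H]]]. exact H.
    + intros H. destruct (strcode_surj (un2 x)) as [s Hs]. exists (un1 x), s.
      assert (E : x = cpair (un1 x) (strcode s)) by (rewrite Hs; symmetry; apply cpair_unpair).
      split; [exact E|]. unfold test. now rewrite <- E.
  - intros m l [HN _] Hl.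
    assert (HI : exists I, forall s, In s l -> exists i z, (i < I)%nat /\
      least_chk e i (m + i + 1) z = true /\ inT (z_len z) (z_set z) (strcode s) = true).
    { clear HN. induction l as [|s l IH]; [exists 0%nat; intros s []|].
      destruct IH as [I HI]; [intros; apply Hl; now right|].
      destruct (Hl s (or_introl eq_refl)) as [u Hu]. unfold enumerates in Hu.
      rewrite un1_cpair, un2_cpair, andb_true_iff in Hu.
      exists (max I (S (un1 u))). intros s' [<-|Hs].
      - exists (un1 u), (un2 u). split; [lia|exact Hu].
      - destruct (HI s' Hs) as [i [z [Hi H]]]. exists i, z. split; [lia|exact H]. }
    destruct HI as [I HI]. eapply Rle_trans; [apply (ssum_stages e m I l HN HI)|].
    assert (0 < (/ 2) ^ m) by (apply pow_lt; lra). assert (0 < (/ 2) ^ I) by (apply pow_lt; lra). nra.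
Qed.

(** * Success of the search for label sets *)

Lemma wtn_wt N0 N v : INR (wtn N0 N v) = wt (Nat.testbit v) N0 N * 2 ^ N.
Proof.
  unfold wtn. assert (H : forall b, (b <= N)%nat ->
    INR (nsum b (fun x => Nat.b2n ((N0 <=? x)%nat && Nat.testbit v x) * 2 ^ (N - un1 x))%nat) =
    wt (Nat.testbit v) N0 b * 2 ^ N); [|now apply H].
  induction b as [|b IH]; intros Hb; [simpl; lra|]. cbn [nsum wt].
  rewrite plus_INR, IH by lia. rewrite mult_INR, pow_INR. replace (INR 2) with 2 by (simpl; lra).
  destruct ((N0 <=? b)%nat && Nat.testbit v b); simpl Nat.b2n; simpl INR; [|lra].
  unfold w. pose proof (un1_le b).
  assert (E : (/ 2) ^ un1 b * 2 ^ N = 2 ^ (N - un1 b)).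
  { replace N with (un1 b + (N - un1 b))%nat at 1 by lia.
    rewrite pow_add, <- Rmult_assoc, <- Rpow_mult_distr, Rinv_l, pow1 by lra. lra. }
  rewrite Rmult_plus_distr_r, E. lra.
Qed.

Lemma wt_split_diff f D a b : wt f a b <= wt D a b + wt (diff f D) a b.
Proof. apply wt_le_sum. intros x _ Hx. rewrite diff_true. destruct (D x); tauto. Qed.

Lemma small_wtn N0 N a v : (wtn N0 N v * 2 ^ a < 2 ^ N)%nat <-> wt (Nat.testbit v) N0 N < (/ 2) ^ a.
Proof.
  assert (0 < 2 ^ a) by (apply pow_lt; lra). assert (0 < 2 ^ N) by (apply pow_lt; lra).
  assert (E : (/ 2) ^ a * 2 ^ a = 1) by (rewrite pow_inv; field; lra).
  assert (0 < (/ 2) ^ a) by (apply pow_lt; lra).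
  set (x := wt (Nat.testbit v) N0 N).
  assert (F : INR (wtn N0 N v * 2 ^ a) = x * 2 ^ N * 2 ^ a).
  { rewrite mult_INR, wtn_wt, pow_INR. replace (INR 2) with 2 by (simpl; lra). reflexivity. }
  assert (F' : INR (2 ^ N) = 2 ^ N).
  { rewrite pow_INR. replace (INR 2) with 2 by (simpl; lra). reflexivity. }
  split; intros Hl.
  - apply lt_INR in Hl. rewrite F, F' in Hl. apply Rmult_lt_reg_r with (2 ^ N * 2 ^ a); nra.
  - apply INR_lt. rewrite F, F'.
    apply Rmult_lt_compat_r with (r := 2 ^ N * 2 ^ a) in Hl; [|nra].
    replace ((/ 2) ^ a * (2 ^ N * 2 ^ a)) with (2 ^ N * ((/ 2) ^ a * 2 ^ a)) in Hl by ring.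
    rewrite E in Hl. lra.
Qed.

Lemma bounded_wtn N0 N a v :
  (wtn N0 N v * 2 ^ a <= 8 * 2 ^ N)%nat <-> wt (Nat.testbit v) N0 N <= 8 * (/ 2) ^ a.
Proof.
  assert (0 < 2 ^ a) by (apply pow_lt; lra). assert (0 < 2 ^ N) by (apply pow_lt; lra).
  assert (E : (/ 2) ^ a * 2 ^ a = 1) by (rewrite pow_inv; field; lra).
  set (x := wt (Nat.testbit v) N0 N).
  assert (F : INR (wtn N0 N v * 2 ^ a) = x * 2 ^ N * 2 ^ a).
  { rewrite mult_INR, wtn_wt, pow_INR. replace (INR 2) with 2 by (simpl; lra). reflexivity. }
  assert (F' : INR (8 * 2 ^ N) = 8 * 2 ^ N).
  { rewrite mult_INR, pow_INR. replace (INR 2) with 2 by (simpl; lra).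
    replace (INR 8) with 8 by (simpl; lra). reflexivity. }
  assert (Q : 8 * (/ 2) ^ a * (2 ^ N * 2 ^ a) = 8 * 2 ^ N).
  { replace (8 * (/ 2) ^ a * (2 ^ N * 2 ^ a)) with (8 * 2 ^ N * ((/ 2) ^ a * 2 ^ a)) by ring.
    rewrite E. ring. }
  split; intros Hl.
  - apply le_INR in Hl. rewrite F, F' in Hl. apply Rmult_le_reg_r with (2 ^ N * 2 ^ a); [nra|]. lra.
  - apply INR_le. rewrite F, F'.
    apply Rmult_le_compat_r with (r := 2 ^ N * 2 ^ a) in Hl; [|nra]. lra.
Qed.

Lemma hit_conv e z v : hit e z v = true ->
  exists s, inT (z_len z) (z_set z) (strcode s) = true /\ conv e (z_dom z) (Nat.testbit v) s.
Proof.
  intros H. apply bex_spec in H. destruct H as [c [_ H]]. apply andb_true_iff in H.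
  destruct H as [HT H]. destruct (strcode_surj c) as [s <-]. exists s. split; [exact HT|].
  apply inT_strcode in HT. destruct HT as [_ HL].
  exists (z_fuel z). intros x Hx. rewrite ball_spec in H.
  specialize (H x ltac:(lia)). apply Nat.eqb_eq in H. now rewrite H, strcode_bit.
Qed.

Lemma set_mask n (T : list (list bool)) : (forall t, In t T -> length t = n) ->
  exists v, (forall t, In t T -> inT n v (strcode t) = true) /\ (cntT n v <= length T)%nat.
Proof.
  intros HT. destruct (mask_exists (2 ^ S n) (fun c => existsb (fun t => strcode t =? c)%nat T))
    as [v [_ Hv]]. exists v. split.
  - intros t Ht. apply inT_strcode. split; [|now apply HT]. rewrite Hv.
    + apply existsb_exists. exists t. split; [exact Ht|apply Nat.eqb_refl].
    + pose proof (strcode_bounds t). rewrite (HT t Ht) in H. lia.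
  - unfold cntT. rewrite nsum_filter, <- (length_map strcode T).
    apply NoDup_incl_length; [apply NoDup_filter, seq_NoDup|].
    intros c Hc. apply filter_In in Hc. destruct Hc as [Hc HT']. apply in_seq in Hc.
    unfold inT in HT'. rewrite !andb_true_iff in HT'. destruct HT' as [[Hb _] _].
    rewrite Hv in Hb by lia. apply existsb_exists in Hb. destruct Hb as [t [Ht E]].
    apply Nat.eqb_eq in E. subst c. now apply in_map.
Qed.

(** Turns the label set provided by [level_all] into a coded candidate. Finitely many obstructions
    have to be met below [N], so one fuel bound suffices for all of them. *)
Lemma chk_exists e sg N0 a D beta q :
  nonpartial e (Nat.testbit sg) N0 D beta -> 16 * (/ 2) ^ a <= beta ->
  (forall L, wt D N0 L <= (/ 2) ^ a) ->
  exists z, chk e (cpair sg (cpair N0 a)) q z = true.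
Proof.
  intros HNP Hb HD. set (eps := (/ 2) ^ a) in *.
  assert (He : 0 < eps) by (apply pow_lt; lra).
  (* Three rounds shrink the measure by 27/64, hence at least by half. *)
  destruct (level_all e (Nat.testbit sg) N0 D beta eps (3 * q) HNP He Hb)
    as [N [n [T [HN [HT [Hcnt Hlev]]]]]].
  destruct (set_mask n T HT) as [v [Hv1 Hv2]].
  set (i := cpair sg (cpair N0 a)).
  set (zz := fun k => cpair k (cpair N (cpair n v))).
  assert (Ei : i_str i = sg /\ i_len i = N0 /\ i_exp i = a).
  { unfold i_str, i_len, i_exp, i. now rewrite ?un2_cpair, ?un1_cpair, ?un2_cpair. }
  assert (Ez : forall k, z_fuel (zz k) = k /\ z_dom (zz k) = N /\ z_len (zz k) = n /\ z_set (zz k) = v).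
  { intros k. unfold z_fuel, z_dom, z_len, z_set, zz.
    rewrite ?un2_cpair, ?un1_cpair. tauto. }
  destruct Ei as [Ei1 [Ei2 Ei3]].
  destruct (common_bound (seq 0 (2 ^ N)) (fun E k =>
    wt (Nat.testbit E) N0 N < eps ->
    exists u, (u < 2 ^ N)%nat /\ extends i (zz k) E u = true /\ hit e (zz k) u = true)) as [k Hk].
  { intros E _. destruct (Rlt_dec (wt (Nat.testbit E) N0 N) eps) as [HE|HE];
      [|exists 0%nat; intros; contradiction].
    assert (HE' : wt (diff (Nat.testbit E) D) N0 N <= wt (Nat.testbit E) N0 N).
    { apply wt_le. intros x _ Hx. now apply diff_true in Hx. }
    destruct (Hlev (Nat.testbit E)) as [tau [A1 [A2 [A3 [A4 [t [Ht [k Ck]]]]]]]]; [lra|].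
    destruct (mask_exists N tau) as [u [Hu Hut]].
    exists k. intros k' Hk' _. exists u. split; [exact Hu|].
    destruct (Ez k') as [Ez1 [Ez2 [Ez3 Ez4]]]. split.
    - unfold extends. rewrite Ei1, Ei2, Ei3, Ez2, !andb_true_iff, !ball_spec, Nat.leb_le, bounded_wtn.
      split; [split|].
      + intros x Hx. apply Nat.eqb_eq. rewrite Hut by lia. now rewrite <- A1.
      + intros x Hx. rewrite Hut by lia. destruct (Nat.leb_spec N0 x); [|reflexivity]. simpl.
        destruct (Nat.testbit E x) eqn:Ex; [|reflexivity]. simpl. now apply A3.
      + apply Rle_trans with (wt tau N0 N).
        { apply wt_le. intros x Hx. now rewrite Hut by lia. }
        (* The excess over [D] is at most 5 eps and [D] itself weighs at most eps there, so the
           bound 8 eps holds. *)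
        pose proof (wt_split_diff tau D N0 N). pose proof (HD N).
        assert (0 < (1 / 2) ^ (3 * q)) by (apply pow_lt; lra). fold eps. nra.
    - apply bex_spec. exists (strcode t). rewrite Ez1, Ez2, Ez3, Ez4. split.
      + pose proof (strcode_bounds t). rewrite (HT t Ht) in H. lia.
      + rewrite Hv1 by exact Ht. apply ball_spec. intros x Hx. apply Nat.eqb_eq.
        rewrite strcode_bit by (rewrite (HT t Ht); exact Hx).
        eapply run_mono; [apply Ck; rewrite (HT t Ht); exact Hx|exact Hk'|lia|].
        intros y Hy. symmetry. now apply Hut. }
  specialize (Hk k (le_n _)). exists (zz k). destruct (Ez k) as [Ez1 [Ez2 [Ez3 Ez4]]].
  unfold chk. rewrite !andb_true_iff, Ei2, Ez2, Ez3, Ez4, !Nat.leb_le.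
  split; [split; [exact HN|]|].
  - clear - Hcnt Hv2. rewrite !Nat.pow_mul_r in Hcnt.
    change (4 ^ 3)%nat with 64%nat in Hcnt. change (3 ^ 3)%nat with 27%nat in Hcnt.
    assert (H : (27 ^ q * 2 ^ q <= 64 ^ q)%nat).
    { rewrite <- Nat.pow_mul_l. apply Nat.pow_le_mono_l. lia. }
    assert (0 < 27 ^ q)%nat by (apply Nat.neq_0_lt_0, Nat.pow_nonzero; lia).
    assert (27 ^ q * (length T * 2 ^ q) <= 27 ^ q * 2 ^ n)%nat by nia.
    apply Nat.mul_le_mono_pos_l in H1; [nia|assumption].
  - unfold big. rewrite Ei2, Ei3, Ez2. apply ball_spec. intros E HE.
    destruct (Nat.ltb_spec (wtn N0 N E * 2 ^ a) (2 ^ N)) as [L|L]; [|reflexivity]. simpl.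
    apply small_wtn in L. destruct (Hk E) as [u [Hu1 [Hu2 Hu3]]]; [apply in_seq; lia|exact L|].
    apply bex_spec. exists u. split; [exact Hu1|]. now rewrite Hu2, Hu3.
Qed.

Lemma least_chk_exists e i q : (exists z, chk e i q z = true) -> exists z, least_chk e i q z = true.
Proof.
  intros [z Hz]. induction z as [z IH] using lt_wf_ind.
  destruct (classic (exists z', (z' < z)%nat /\ chk e i q z' = true)) as [[z' [L H]]|C]; [eauto|].
  exists z. unfold least_chk. rewrite Hz. apply ball_spec. intros z' L.
  destruct (chk e i q z') eqn:E; [exfalso; eauto|reflexivity].
Qed.

(** * The forcing construction *)

(* The set called [D] in the header is [c_req]; it only matters from [c_len] on. *)
Record cond := Cond { c_str : nat -> bool; c_len : nat; c_req : nat -> bool; c_bud : R }.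

Definition summable (f : nat -> bool) : Prop := exists B, forall L, wt f 0 L <= B.
Definition wf (p : cond) : Prop := 0 < c_bud p /\ summable (c_req p).

(** Three amounts are charged to the old budget: the excess put into the stem, the weight added to
    the promise beyond the new stem, and the budget that remains. The bound for all [L] controls the
    whole infinite tail. *)
Definition ext (p p' : cond) : Prop :=
  (c_len p <= c_len p')%nat /\ agree (c_len p) (c_str p) (c_str p') /\
  sub_on (c_len p) (c_len p') (c_req p) (c_str p') /\
  (forall x, c_req p x = true -> c_req p' x = true) /\
  forall L, wt (diff (c_str p') (c_req p)) (c_len p) (c_len p') +
            wt (diff (c_req p') (c_req p)) (c_len p') L + c_bud p' <= c_bud p.

Lemma diff_self_wt f a b : wt (diff f f) a b = 0.
Proof. apply wt_none. intros x _. unfold diff. now destruct (f x). Qed.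

Lemma ext_refl p : ext p p.
Proof.
  split; [lia|]. split; [apply agree_refl|]. split; [intros x Hx; lia|]. split; [auto|].
  intros L. rewrite wt_empty, diff_self_wt by lia. lra.
Qed.

Lemma wt_diff_trans f D D' a b : wt (diff f D) a b <= wt (diff f D') a b + wt (diff D' D) a b.
Proof. apply wt_le_sum. intros x _. rewrite !diff_true. destruct (D' x); tauto. Qed.

Lemma ext_trans p p' p'' : ext p p' -> ext p' p'' -> ext p p''.
Proof.
  intros [L1 [A1 [S1 [R1 W1]]]] [L2 [A2 [S2 [R2 W2]]]].
  split; [lia|]. split; [|split; [|split]].
  - intros x Hx. rewrite A1 by exact Hx. apply A2. lia.
  - intros x Hx Hd. destruct (le_lt_dec (c_len p') x).
    + apply S2; [lia|]. now apply R1.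
    + rewrite <- A2 by lia. apply S1; [lia|exact Hd].
  - auto.
  (* On the stretch between the last two stems, the excess over the oldest promise splits into
     excess over the middle promise and weight newly promised by [p']; the first inequality, taken
     up to [K], pays for the latter. *)
  - intros L. set (K := max L (c_len p'')). specialize (W1 K). specialize (W2 L).
    rewrite (wt_chasles _ (c_len p) (c_len p') (c_len p'')) by lia.
    assert (wt (diff (c_str p'') (c_req p)) (c_len p) (c_len p') <=
            wt (diff (c_str p') (c_req p)) (c_len p) (c_len p')).
    { apply wt_le. intros x Hx. rewrite !diff_true, A2 by lia. auto. }
    rewrite (wt_chasles (diff (c_req p') (c_req p)) (c_len p') (c_len p'') K) in W1 by (unfold K; lia).
    pose proof (wt_diff_trans (c_str p'') (c_req p) (c_req p') (c_len p') (c_len p'')).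
    pose proof (wt_diff_trans (c_req p'') (c_req p) (c_req p') (c_len p'') L).
    pose proof (wt_mono_r (diff (c_req p') (c_req p)) (c_len p'') L K ltac:(unfold K; lia)).
    lra.
Qed.

(** An initial segment within [delta] of the supremum of the partial weights leaves a tail of at
    most [delta]. *)
Lemma summable_tail f delta : summable f -> 0 < delta ->
  exists K, forall K' L, (K <= K')%nat -> wt f K' L <= delta.
Proof.
  intros [B HB] Hd.
  destruct (completeness (fun r => exists L, r = wt f 0 L)) as [S [HS1 HS2]].
  - exists B. intros r [L ->]. apply HB.
  - exists (wt f 0 0), 0%nat. reflexivity.
  - assert (HK : exists K, S - delta < wt f 0 K).
    { apply NNPP. intros C. assert (S <= S - delta); [|lra].
      apply HS2. intros r [L ->]. apply Rnot_lt_le. intros C'. apply C. eauto. }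
    destruct HK as [K HK]. exists K. intros K' L HL.
    destruct (le_lt_dec K' L) as [L1|L1]; [|rewrite wt_empty by lia; lra].
    assert (wt f 0 L <= S) by (apply HS1; eauto).
    rewrite (wt_chasles f 0 K' L) in H by lia.
    pose proof (wt_mono_r f 0 K K' HL). lra.
Qed.

Lemma summable_union f g : summable f -> (exists N B, forall L, wt (diff g f) N L <= B) ->
  summable (union f g).
Proof.
  intros [B HB] [N [B' HB']]. exists (B + (wt (diff g f) 0 N + B')). intros L.
  assert (wt (union f g) 0 L <= wt f 0 L + wt (diff g f) 0 L).
  { apply wt_le_sum. intros x _. rewrite union_true, diff_true. destruct (f x); tauto. }
  pose proof (wt_mono_r (diff g f) 0 L (max N L) ltac:(lia)).
  rewrite (wt_chasles (diff g f) 0 N (max N L)) in H0 by lia.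
  specialize (HB L). specialize (HB' (max N L)). lra.
Qed.

(** Continuing the stem by exactly the promised elements costs nothing. *)
Lemma lengthen p K : wf p -> exists p', ext p p' /\ wf p' /\ (K <= c_len p')%nat /\
  c_req p' = c_req p /\ c_bud p' = c_bud p.
Proof.
  intros Hp.
  exists (Cond (fun x => if (x <? c_len p)%nat then c_str p x else c_req p x)
            (max K (c_len p)) (c_req p) (c_bud p)).
  split; [|split; [exact Hp|split; [simpl; lia|split; reflexivity]]].
  split; [simpl; lia|]. simpl. split; [|split; [|split]].
  - intros x Hx. destruct (Nat.ltb_spec x (c_len p)); [reflexivity|lia].
  - intros x Hx. destruct (Nat.ltb_spec x (c_len p)); [lia|auto].
  - auto.
  - intros L. rewrite diff_self_wt, wt_none; [lra|]. intros x Hx. unfold diff.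
    destruct (Nat.ltb_spec x (c_len p)); [lia|]. now destruct (c_req p x).
Qed.

(** The stem is lengthened until the tail of [f] weighs at most half of the budget; the other half
    is kept. *)
Lemma force_cover p f : wf p -> summable f ->
  exists p', ext p p' /\ wf p' /\ forall x, f x = true -> c_req p' x = true.
Proof.
  intros Hp Hf. pose proof (proj1 Hp) as Hb.
  destruct (summable_tail f (c_bud p / 2) Hf ltac:(lra)) as [K HK].
  destruct (lengthen p K Hp) as [p1 [E1 [H1 [HK1 [Er Eb]]]]].
  exists (Cond (c_str p1) (c_len p1) (union (c_req p1) f) (c_bud p1 / 2)).
  assert (HT : forall L, wt (diff f (c_req p1)) (c_len p1) L <= c_bud p / 2).
  { intros L. eapply Rle_trans; [|apply (HK (c_len p1) L HK1)].
    apply wt_le. intros x _ Hx. now apply diff_true in Hx. }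
  split; [|split].
  - apply ext_trans with p1; [exact E1|]. split; [simpl; lia|]. simpl.
    split; [apply agree_refl|]. split; [intros x Hx; lia|]. split.
    + intros x Hx. apply union_true. now left.
    + intros L. rewrite wt_empty by lia. rewrite Eb. specialize (HT L).
      assert (wt (diff (union (c_req p1) f) (c_req p1)) (c_len p1) L <=
              wt (diff f (c_req p1)) (c_len p1) L).
      { apply wt_le. intros x _. rewrite !diff_true, union_true.
        intros [[Hx|Hx] Hy]; [congruence|tauto]. }
      lra.
  - split; simpl; [lra|]. apply summable_union; [apply H1|]. eauto.
  - intros x Hx. simpl. apply union_true. now right.
Qed.

Definition diverges e p : Prop := exists n, forall M rho s,
  (c_len p <= M)%nat -> agree (c_len p) (c_str p) rho -> sub_on (c_len p) M (c_req p) rho ->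
  wt (diff rho (c_req p)) (c_len p) M <= c_bud p -> length s = n -> ~ conv e M rho s.

Definition captured e m p : Prop := exists s, test e m s /\ conv e (c_len p) (c_str p) s.

(** Either some extension forces partiality, or [chk_exists] makes the search of the test succeed
    for the stem of [p1], and bigness against the promised set yields an extension with a label in
    the test. *)
Lemma force_test e m p : wf p -> exists p', ext p p' /\ wf p' /\ (diverges e p' \/ captured e m p').
Proof.
  intros Hp. pose proof (proj1 Hp) as Hb.
  (* With eps below a sixteenth of the budget, the excess of 8 eps allowed by [extends] costs at
     most half of it. *)
  destruct (pow_lt_1_zero (/ 2) ltac:(rewrite Rabs_right; lra) (c_bud p / 16) ltac:(lra)) as [a Ha].
  specialize (Ha a (le_n _)).
  assert (He : 0 < (/ 2) ^ a) by (apply pow_lt; lra).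
  rewrite Rabs_right in Ha by lra. set (eps := (/ 2) ^ a) in *.
  (* The bound eps / 2 makes the promised tail strictly lighter than eps, as [big] demands. *)
  destruct (summable_tail (c_req p) (eps / 2) (proj2 Hp) ltac:(lra)) as [K HK].
  destruct (lengthen p K Hp) as [p1 [E1 [H1 [HK1 [Er Eb]]]]].
  assert (HD : forall L, wt (c_req p1) (c_len p1) L <= eps / 2) by (rewrite Er; intros; now apply HK).
  set (D := c_req p1) in *. set (N0 := c_len p1) in *.
  destruct (classic (nonpartial e (c_str p1) N0 D (c_bud p1))) as [HNP|HNP].
  - destruct (mask_exists N0 (c_str p1)) as [sg [_ Hsg]].
    assert (HNP' : nonpartial e (Nat.testbit sg) N0 D (c_bud p1)).
    { intros N tau E n u v eta HN Hag. apply HNP; [exact HN|].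
      intros x Hx. rewrite <- Hsg by exact Hx. now apply Hag. }
    set (i := cpair sg (cpair N0 a)).
    destruct (least_chk_exists e i (m + i + 1)) as [z Hz].
    { eapply chk_exists; [exact HNP'|rewrite Eb; fold eps; lra|].
      intros L. fold eps. specialize (HD L). lra. }
    assert (Ei : i_str i = sg /\ i_len i = N0 /\ i_exp i = a).
    { unfold i_str, i_len, i_exp, i. now rewrite ?un2_cpair, ?un1_cpair, ?un2_cpair. }
    destruct Ei as [Ei1 [Ei2 Ei3]].
    pose proof Hz as Hz'. unfold least_chk, chk in Hz'. rewrite !andb_true_iff, Ei2, Nat.leb_le in Hz'.
    destruct Hz' as [[[HN _] HB] _]. unfold big in HB. rewrite ball_spec, Ei2, Ei3 in HB.
    set (N := z_dom z) in *.
    (* The obstruction chosen is the promised set itself, so the extension found respects the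
       promise. *)
    destruct (mask_exists N D) as [d [Hd HdD]]. specialize (HB d Hd).
    assert (HdW : wt (Nat.testbit d) N0 N < (/ 2) ^ a).
    { fold eps. apply Rle_lt_trans with (wt D N0 N); [|specialize (HD N); lra].
      apply wt_le. intros x Hx. now rewrite HdD by lia. }
    apply small_wtn, Nat.ltb_lt in HdW. rewrite HdW in HB. simpl in HB.
    apply bex_spec in HB. destruct HB as [v [_ HB]]. apply andb_true_iff in HB. destruct HB as [HE HH].
    unfold extends in HE. rewrite !andb_true_iff, !ball_spec, Ei1, Ei2, Ei3, Nat.leb_le, bounded_wtn in HE.
    fold N in HE. fold eps in HE. destruct HE as [[HE1 HE2] HE3].
    destruct (hit_conv e z v HH) as [s [HsT HsC]]. fold N in HsC.
    exists (Cond (Nat.testbit v) N D (c_bud p1 / 2)). split; [|split].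
    + apply ext_trans with p1; [exact E1|]. split; [exact HN|]. fold N0. fold D. simpl.
      split; [|split; [|split]].
      * intros x Hx. specialize (HE1 x Hx). apply Nat.eqb_eq in HE1. rewrite <- Hsg by exact Hx.
        destruct (Nat.testbit v x), (Nat.testbit sg x); simpl in HE1; congruence.
      * intros x Hx Hd'. specialize (HE2 x ltac:(lia)). rewrite HdD, Hd' in HE2 by lia.
        destruct (Nat.leb_spec N0 x); [|lia]. exact HE2.
      * auto.
      * intros L. rewrite diff_self_wt.
        assert (wt (diff (Nat.testbit v) D) N0 N <= wt (Nat.testbit v) N0 N).
        { apply wt_le. intros x _ Hx. now apply diff_true in Hx. }
        lra.
    + split; simpl; [lra|apply H1].
    + right. exists s. split; [|exact HsC]. exists (cpair i z).
      unfold enumerates. rewrite !un1_cpair, !un2_cpair. now rewrite Hz, HsT.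
  - assert (C : exists N tau E n u v eta, (N0 <= N)%nat /\ agree N0 (c_str p1) tau /\
      sub_on N0 N D tau /\ wt (diff tau D) N0 N <= u /\ (forall L, wt (diff E D) N L <= v) /\
      0 < eta /\ u + v + eta <= c_bud p1 /\
      ~ exists M rho s, (N <= M)%nat /\ agree N tau rho /\ sub_on N M D rho /\ sub_on N M E rho /\
        wt (diff rho (union D E)) N M <= eta /\ length s = n /\ conv e M rho s).
    { apply NNPP. intros C. apply HNP. intros N tau E n u v eta h1 h2 h3 h4 h5 h6 h7.
      apply NNPP. intros C'. apply C. exists N, tau, E, n, u, v, eta. tauto. }
    destruct C as [N [tau [E [n [u [v [eta [h1 [h2 [h3 [h4 [h5 [h6 [h7 C]]]]]]]]]]]]]].
    (* The failure of [nonpartial] supplies a stem, an additional promise and a remaining budget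
       that together exclude every output of length [n]. *)
    exists (Cond tau N (union D E) eta). split; [|split].
    + apply ext_trans with p1; [exact E1|]. split; [exact h1|]. fold N0. fold D. simpl.
      split; [exact h2|]. split; [exact h3|]. split.
      * intros x Hx. apply union_true. now left.
      * intros L. assert (wt (diff (union D E) D) N L <= wt (diff E D) N L).
        { apply wt_le. intros x _. rewrite !diff_true, union_true.
          intros [[Hx|Hx] Hy]; [congruence|tauto]. }
        specialize (h5 L). lra.
    + split; simpl; [exact h6|]. apply summable_union; [apply H1|]. eauto.
    + left. exists n. simpl. intros M rho s g1 g2 g3 g4 g5 g6. apply C. exists M, rho, s.
      split; [exact g1|]. split; [exact g2|]. split; [|split; [|tauto]].
      * intros x Hx Hd. apply g3; [exact Hx|]. apply union_true. now left.
      * intros x Hx Hd. apply g3; [exact Hx|]. apply union_true. now right.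
Qed.

(** * A generic sequence of conditions and its limit *)

Fixpoint code_num (c : code) : nat :=
  match c with
  | CZero => cpair 0 0
  | CSucc => cpair 1 0
  | CId => cpair 2 0
  | CFst => cpair 3 0
  | CSnd => cpair 4 0
  | COrc => cpair 5 0
  | CComp f g => cpair 6 (cpair (code_num f) (code_num g))
  | CPair f g => cpair 7 (cpair (code_num f) (code_num g))
  | CRec f g => cpair 8 (cpair (code_num f) (code_num g))
  | CMu f => cpair 9 (code_num f)
  end.

Lemma code_num_inj c : forall c', code_num c = code_num c' -> c = c'.
Proof.
  induction c; intros [] E; cbn [code_num] in E; cpair_eqs; try discriminate; try reflexivity;
    f_equal; auto.
Qed.

Lemma code_enumeration : exists dec : nat -> code, forall c, exists k, dec k = c.
Proof.
  exists (fun k => epsilon (inhabits CZero) (fun c => code_num c = k)).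
  intros c. exists (code_num c). apply code_num_inj.
  apply (epsilon_spec (inhabits CZero) (fun c' => code_num c' = code_num c)). eauto.
Qed.

Definition domain (c : code) (x : nat) : bool :=
  if excluded_middle_informative (exists y, ev empty_oracle c x y) then true else false.

(** The code [c] is used twice, as an index of a c.e. set to be covered and as a functional to be
    kept from computing a random real. *)
Definition stage (c : code) (m K : nat) (p p' : cond) : Prop :=
  ext p p' /\ wf p' /\ (K <= c_len p')%nat /\
  (summable (domain c) -> forall x, domain c x = true -> c_req p' x = true) /\
  (diverges c p' \/ captured c m p').

Lemma stage_exists c m K p : wf p -> exists p', stage c m K p p'.
Proof.
  intros Hp. destruct (lengthen p K Hp) as [p1 [E1 [H1 [L1 _]]]].
  assert (Hcov : exists p2, ext p1 p2 /\ wf p2 /\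
    (summable (domain c) -> forall x, domain c x = true -> c_req p2 x = true)).
  { destruct (classic (summable (domain c))) as [Hs|Hs].
    - destruct (force_cover p1 _ H1 Hs) as [p2 [E2 [H2 R2]]]. exists p2. tauto.
    - exists p1. split; [apply ext_refl|]. tauto. }
  destruct Hcov as [p2 [E2 [H2 R2]]].
  destruct (force_test c m p2 H2) as [p3 [E3 [H3 R3]]].
  exists p3. split; [eapply ext_trans; [exact E1|]; eapply ext_trans; eauto|].
  split; [exact H3|]. split; [destruct E2 as [? _], E3 as [? _]; lia|].
  split; [|exact R3]. intros Hs x Hx. destruct E3 as [_ [_ [_ [R _]]]]. apply R. now apply R2.
Qed.

Lemma generic_chain (dec : nat -> code) : exists P : nat -> cond,
  P 0%nat = Cond (fun _ => false) 0 (fun _ => false) 1 /\ (forall k, wf (P k)) /\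
  forall k, stage (dec (un1 k)) (un2 k) k (P k) (P (S k)).
Proof.
  set (p0 := Cond (fun _ => false) 0 (fun _ => false) 1).
  assert (H0 : wf p0).
  { split; simpl; [lra|]. exists 0. intros L. rewrite wt_none; [lra|reflexivity]. }
  set (next := fun k p => epsilon (inhabits p0) (stage (dec (un1 k)) (un2 k) k p)).
  assert (Hn : forall k p, wf p -> stage (dec (un1 k)) (un2 k) k p (next k p)).
  { intros k p Hp. apply epsilon_spec. now apply stage_exists. }
  set (P := nat_rect (fun _ => cond) p0 next).
  assert (HP : forall k, wf (P k)).
  { induction k as [|k IH]; [exact H0|]. exact (proj1 (proj2 (Hn k (P k) IH))). }
  exists P. split; [reflexivity|]. split; [exact HP|]. intros k. exact (Hn k (P k) (HP k)).
Qed.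

Definition meets (g : nat -> bool) (p : cond) : Prop :=
  agree (c_len p) (c_str p) g /\
  (forall x, (c_len p <= x)%nat -> c_req p x = true -> g x = true) /\
  forall L, wt (diff g (c_req p)) (c_len p) L <= c_bud p.

Lemma chain_limit (P : nat -> cond) :
  (forall k, wf (P k)) -> (forall k, ext (P k) (P (S k))) -> (forall k, (k <= c_len (P (S k)))%nat) ->
  exists g, forall k, meets g (P k).
Proof.
  intros Hwf He Hl.
  assert (HE : forall k l, (k <= l)%nat -> ext (P k) (P l)).
  { intros k l H. induction H as [|l H IH]; [apply ext_refl|]. now apply ext_trans with (P l). }
  (* The stem of [P (S (S x))] has length at least x + 1, so it already decides x. *)
  exists (fun x => c_str (P (S (S x))) x).
  assert (HA : forall l x, (x < c_len (P l))%nat -> c_str (P l) x = c_str (P (S (S x))) x).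
  { intros l x Hx. destruct (le_lt_dec l (S (S x))) as [L|L].
    - destruct (HE _ _ L) as [_ [A _]]. now apply A.
    - destruct (HE (S (S x)) l ltac:(lia)) as [_ [A _]]. symmetry. apply A. specialize (Hl (S x)). lia. }
  intros k. split; [|split].
  - intros x Hx. now apply HA.
  - intros x Hx Hr. set (l := max k (S (S x))).
    assert (Hxl : (x < c_len (P l))%nat).
    { destruct (HE (S (S x)) l ltac:(lia)) as [Hle _]. specialize (Hl (S x)). lia. }
    rewrite <- (HA l x Hxl). destruct (HE k l ltac:(lia)) as [_ [_ [S1 _]]]. apply S1; [lia|exact Hr].
  - intros L. set (l := max k (S L)).
    assert (HLl : (L <= c_len (P l))%nat).
    { destruct (HE (S L) l ltac:(lia)) as [Hle _]. specialize (Hl L). lia. }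
    destruct (HE k l ltac:(lia)) as [_ [_ [_ [_ W]]]]. specialize (W (c_len (P l))).
    rewrite (wt_empty _ (c_len (P l)) (c_len (P l))) in W by lia.
    pose proof (proj1 (Hwf l)).
    apply Rle_trans with (wt (diff (c_str (P l)) (c_req (P k))) (c_len (P k)) (c_len (P l))); [|lra].
    eapply Rle_trans; [apply wt_mono_r; exact HLl|].
    apply wt_le. intros x Hx. rewrite !diff_true, (HA l) by lia. auto.
Qed.

(** * Weights of lists and weights of sets *)

Lemma wsum_le_wt g L : forall l, NoDup l ->
  (forall p, In p l -> g (cpair (fst p) (snd p)) = true /\ (cpair (fst p) (snd p) < L)%nat) ->
  wsum l <= wt g 0 L.
Proof.
  induction L as [|L IH]; intros l HN H.
  - destruct l as [|p l]; [simpl; lra|]. destruct (H p (or_introl eq_refl)). lia.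
  (* If the pair with code [L] occurs, it is removed and paid for by the last summand of the
     weight. *)
  - destruct (classic (In (un1 L, un2 L) l)) as [Hin|Hin].
    + destruct (in_split _ _ Hin) as [l1 [l2 ->]].
      assert (E : wsum (l1 ++ (un1 L, un2 L) :: l2) = w L + wsum (l1 ++ l2)).
      { clear. induction l1 as [|p l1 IH]; simpl in *; [reflexivity|]. rewrite IH. lra. }
      rewrite E. apply NoDup_remove in HN. destruct HN as [HN Hni].
      assert (wsum (l1 ++ l2) <= wt g 0 L).
      { apply IH; [exact HN|]. intros p Hp. destruct (H p) as [Hg Hlt].
        { apply in_or_app. apply in_app_or in Hp. simpl. tauto. }
        split; [exact Hg|].
        assert (cpair (fst p) (snd p) <> L); [|lia]. intros <-. apply Hni.
        rewrite un1_cpair, un2_cpair. now destruct p. }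
      destruct (H _ Hin) as [Hg _]. simpl fst in Hg. simpl snd in Hg. rewrite cpair_unpair in Hg.
      simpl. rewrite Hg. lra.
    + apply Rle_trans with (wt g 0 L); [|apply wt_mono_r; lia]. apply IH; [exact HN|].
      intros p Hp. destruct (H p Hp) as [Hg Hlt]. split; [exact Hg|].
      assert (cpair (fst p) (snd p) <> L); [|lia]. intros <-. apply Hin.
      rewrite un1_cpair, un2_cpair. now destruct p.
Qed.

Lemma finite_weight_of_wt g B : (forall L, wt g 0 L <= B) ->
  finite_weight (fun n m => g (cpair n m) = true).
Proof.
  intros H. exists B. intros l HN Hl.
  assert (HL : exists L, forall p, In p l -> (cpair (fst p) (snd p) < L)%nat).
  { clear. induction l as [|p l [L IH]]; [exists 0%nat; intros p []|].
    exists (max L (S (cpair (fst p) (snd p)))). intros q [<-|Hq]; [lia|]. specialize (IH q Hq). lia. }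
  destruct HL as [L HL]. eapply Rle_trans; [|apply (H L)].
  apply wsum_le_wt; [exact HN|]. intros p Hp. split; [now apply Hl|now apply HL].
Qed.

(** The list is reversed because [wt] adds the largest code last, which becomes the head of the
    list. *)
Lemma wt_as_wsum g L : wt g 0 L = wsum (map unpair (filter g (rev (seq 0 L)))).
Proof.
  induction L as [|L IH]; [reflexivity|].
  rewrite seq_S, rev_app_distr. simpl. rewrite IH. destruct (g L); simpl; unfold w, un1; lra.
Qed.

Lemma unpair_inj x y : unpair x = unpair y -> x = y.
Proof.
  intros E. rewrite <- (cpair_unpair x), <- (cpair_unpair y). unfold un1, un2. now rewrite E.
Qed.

Lemma summable_of_finite_weight (D : set2) g :
  (forall x, g x = true -> code2 D x) -> finite_weight D -> summable g.
Proof.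
  intros Hg [B HB]. exists B. intros L. rewrite wt_as_wsum. apply HB.
  - apply Injective_map_NoDup; [exact unpair_inj|]. apply NoDup_filter, NoDup_rev, seq_NoDup.
  - intros p Hp. apply in_map_iff in Hp. destruct Hp as [x [<- Hx]]. apply filter_In in Hx.
    destruct Hx as [_ Hx]. destruct (Hg x Hx) as [n [m [-> HD]]].
    change (fst (unpair (cpair n m))) with (un1 (cpair n m)).
    change (snd (unpair (cpair n m))) with (un2 (cpair n m)).
    now rewrite un1_cpair, un2_cpair.
Qed.

Lemma code2_graph g x : code2 (fun n m => g (cpair n m) = true) x <-> g x = true.
Proof.
  split.
  - intros [n [m [-> H]]]. exact H.
  - intros H. exists (un1 x), (un2 x). now rewrite cpair_unpair.
Qed.

Lemma turing_conv (A : nat -> Prop) (g : nat -> bool) e (Z : nat -> bool) :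
  (forall x, A x <-> g x = true) -> (forall x, ev A e x (if Z x then 1%nat else 0%nat)) ->
  forall n, exists L0, forall L, (L0 <= L)%nat -> exists s, length s = n /\ conv e L g s.
Proof.
  intros HA HZ n.
  assert (H : exists k L, forall x, (x < n)%nat -> run e k L g x = S (Nat.b2n (Z x))).
  { induction n as [|n [k [L IH]]]; [exists 0%nat, 0%nat; intros; lia|].
    destruct (run_complete A e n _ (HZ n)) as [k' [L' H]].
    exists (max k k'), (max L L'). intros x Hx. destruct (Nat.eq_dec x n) as [->|].
    - apply (run_mono e k' L' g); [|lia|lia|apply agree_refl].
      rewrite H by (intros z _; apply HA). now destruct (Z n).
    - apply (run_mono e k L g); [apply IH; lia|lia|lia|apply agree_refl]. }
  destruct H as [k [L0 H]]. exists L0. intros L HL.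
  exists (map Z (seq 0 n)). rewrite length_map, length_seq. split; [reflexivity|].
  exists k. rewrite length_map, length_seq. intros x Hx.
  rewrite (nth_indep _ false (Z 0%nat)) by (rewrite length_map, length_seq; exact Hx).
  rewrite map_nth, seq_nth by exact Hx.
  apply (run_mono e k L0 g); [now apply H|lia|exact HL|apply agree_refl].
Qed.

Theorem theorem2p1 :
  exists G : set2,
    finite_weight G /\
    (forall D : set2, ce2 D -> finite_weight D -> almost_sub D G) /\
    (forall Z : nat -> bool, ML_random Z -> ~ turing_le Z (code2 G)).
Proof.
  destruct code_enumeration as [dec Hdec].
  destruct (generic_chain dec) as [P [P0 [Pwf Pst]]].
  destruct (chain_limit P Pwf) as [g Hg].
  { intros k. apply Pst. }
  { intros k. apply Pst. }
  exists (fun n m => g (cpair n m) = true). split; [|split].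
  (* The bound 1 is the initial budget, and the initial promise is empty. *)
  - apply finite_weight_of_wt with 1. intros L.
    destruct (Hg 0%nat) as [_ [_ W]]. rewrite P0 in W. specialize (W L). simpl in W.
    eapply Rle_trans; [|exact W]. apply wt_le. intros x _ Hx. apply diff_true. tauto.
  - intros D [e He] HD. destruct (Hdec e) as [k Hk].
    destruct (Pst (cpair k 0)) as [_ [_ [_ [Hcov _]]]]. rewrite un1_cpair, Hk in Hcov.
    set (p := P (S (cpair k 0))) in *.
    assert (Hdom : forall x, domain e x = true <-> code2 D x).
    { intros x. rewrite He. unfold domain. destruct (excluded_middle_informative _); intuition discriminate. }
    assert (Hs : summable (domain e)).
    { apply summable_of_finite_weight with D; [intros x; apply Hdom|exact HD]. }
    (* After the stage that promises [D], only pairs with codes inside the stem can be missing from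
       the limit. *)
    exists (map unpair (seq 0 (c_len p))). intros n m HDnm HG.
    assert (Hx : domain e (cpair n m) = true) by (apply Hdom; exists n, m; auto).
    destruct (le_lt_dec (c_len p) (cpair n m)) as [L|L].
    + exfalso. apply HG. apply (proj1 (proj2 (Hg (S (cpair k 0))))); [exact L|]. now apply Hcov.
    + replace (n, m) with (unpair (cpair n m)); [apply in_map, in_seq; lia|].
      rewrite (surjective_pairing (unpair (cpair n m))).
      exact (f_equal2 pair (un1_cpair n m) (un2_cpair n m)).
  (* Randomness supplies a level m of the test for [e] that [Z] avoids; the stage treating [e] and m
     contradicts this or the totality of the computation. *)
  - intros Z HZ [e He]. destruct (HZ (test e) (ML_test_test e)) as [m Hm].
    destruct (Hdec e) as [k Hk].
    destruct (Pst (cpair k m)) as [_ [_ [_ [_ Hreq]]]]. rewrite un1_cpair, un2_cpair, Hk in Hreq.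
    destruct (Hg (S (cpair k m))) as [G1 [G2 G3]].
    set (p := P (S (cpair k m))) in *.
    pose proof (fun x => code2_graph g x) as HA.
    destruct Hreq as [[n Hn]|[s [Hs Hc]]].
    (* A long enough initial segment of the limit computes n bits while staying within the condition
       that excludes this. *)
    + destruct (turing_conv _ g e Z HA He n) as [L0 HL].
      destruct (HL (max L0 (c_len p)) ltac:(lia)) as [s [Ls Cs]].
      apply (Hn (max L0 (c_len p)) g s); [lia|exact G1| |apply G3|exact Ls|exact Cs].
      intros x Hx. apply G2. lia.
    (* The captured string is computed from the stem, hence from the limit, so by determinism it is
       a prefix of [Z]. *)
    + apply (Hm s Hs). intros i Hi. destruct Hc as [f Hf]. specialize (Hf i Hi).
      assert (Hev : ev (code2 (fun n m => g (cpair n m) = true)) e i (Nat.b2n (nth i s false))).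
      { eapply run_sound; [exact Hf|]. intros z Hz. rewrite HA. now rewrite G1 by exact Hz. }
      pose proof (ev_det _ _ _ _ _ Hev (He i)) as E.
      destruct (nth i s false), (Z i); simpl in E; congruence.
Qed.
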